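(* For every $n\in\mathbb{N}$, the pure virtual braid group $PvB_n$ is quadratic: if $I$ denotes the augmentation ideal of the rational group ring $\mathbb{Q}PvB_n$, then the associated graded algebra $\operatorname{gr}_I\mathbb{Q}PvB_n=\bigoplus_{m\ge 0} I^m/I^{m+1}$ is a quadratic algebra.
   Context: $PvB_n$ is the group with generators $R_{ij}$, $1\le i\ne j\le n$, and relations $R_{ij}R_{ik}R_{jk}=R_{jk}R_{ik}R_{ij}$ and $R_{ij}R_{kl}=R_{kl}R_{ij}$ for $i,j,k,l$ distinct. For a group $G$ with rational group ring $\mathbb{Q}G$ and augmentation ideal $I$ (kernel of $g\mapsto 1$), $G$ is called quadratic if $\operatorname{gr}_I\mathbb{Q}G=\bigoplus_m I^m/I^{m+1}$ is quadratic, i.e. it is generated by its degree-1 part $V=I/I^2$ and its ideal of relations (the kernel of the natural surjection $TV\to\operatorname{gr}_I\mathbb{Q}G$ from the tensor algebra) is generated by its degree-2 component; equivalently, the natural surjection from $TV/\langle R\rangle$ onto $\operatorname{gr}_I\mathbb{Q}G$, where $R\subseteq V\otimes V$ is the kernel of multiplication $V\otimes V\to I^2/I^3$, is an isomorphism. *)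

(* Defs.v *)
From HB Require Import structures.
From mathcomp Require Import all_boot all_order all_algebra.
From mathcomp Require Import finmap.
From mathcomp.multinomials Require Import monalg.

Set Implicit Arguments.
Unset Strict Implicit.
Unset Printing Implicit Defensive.

Import GRing.Theory.
Local Open Scope ring_scope.

Definition gen (n : nat) := {p : 'I_n * 'I_n | p.1 != p.2}.

Definition Rg (n : nat) (i j : 'I_n) (h : i != j) : gen n :=
  @exist _ (fun p : 'I_n * 'I_n => p.1 != p.2) (i, j) h.

(* letters of the free group: (a, true) = a, (a, false) = a^-1 *)
Definition letter (n : nat) := (gen n * bool)%type.
Definition word (n : nat) := seq (letter n).

Definition pos (n : nat) (a : gen n) : letter n := (a, true).

Inductive pvb_step (n : nat) : word n -> word n -> Prop :=
| pvb_cancel (a : gen n) (b : bool) :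
    pvb_step [:: (a, b); (a, ~~ b)] [::]
| pvb_ybe (i j k : 'I_n) (hij : i != j) (hik : i != k) (hjk : j != k) :
    pvb_step [:: pos (Rg hij); pos (Rg hik); pos (Rg hjk)]
             [:: pos (Rg hjk); pos (Rg hik); pos (Rg hij)]
| pvb_comm (i j k l : 'I_n) (hij : i != j) (hik : i != k) (hil : i != l)
    (hjk : j != k) (hjl : j != l) (hkl : k != l) :
    pvb_step [:: pos (Rg hij); pos (Rg hkl)] [:: pos (Rg hkl); pos (Rg hij)].

Inductive pvb_eq (n : nat) : word n -> word n -> Prop :=
| pvb_refl w : pvb_eq w w
| pvb_sym w1 w2 : pvb_eq w1 w2 -> pvb_eq w2 w1
| pvb_trans w1 w2 w3 : pvb_eq w1 w2 -> pvb_eq w2 w3 -> pvb_eq w1 w3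
| pvb_ctx u v w1 w2 : pvb_step w1 w2 -> pvb_eq (u ++ w1 ++ v) (u ++ w2 ++ v).

(* The rational group ring Q PvB_n, as Q[words] modulo the span of    *)
(* differences of equal words; an element of Q PvB_n is represented   *)
(* by any of its lifts in the free monoid algebra Aw n.               *)

Definition Aw (n : nat) := {malg rat[{fmonom (letter n)}]}.

Definition wd (n : nat) (w : word n) : Aw n := << FMonom w >>.

(* kernel of Q[words] -> Q PvB_n : span of w1 - w2 with w1 = w2 in PvB_n *)
Inductive in_J (n : nat) : Aw n -> Prop :=
| J0 : in_J 0
| Jrel (c : rat) (w1 w2 : word n) (f : Aw n) :
    pvb_eq w1 w2 -> in_J f -> in_J (c *: (wd w1 - wd w2) + f).

(* augmentation (sum of coefficients); well defined on Q PvB_n *)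
Definition aug (n : nat) (f : Aw n) : rat := \sum_(m <- msupp f) f@_m.

(* f represents an element of I^d, I the augmentation ideal
   (I^0 = Q PvB_n, I^(d+1) = span of products a * b, a in I, b in I^d) *)
Inductive in_Ipow (n : nat) : nat -> Aw n -> Prop :=
| Ipow0 f : in_Ipow 0 f
| IpowM d (a b : Aw n) : aug a = 0 -> in_Ipow d b -> in_Ipow d.+1 (a * b)
| IpowD d (f g : Aw n) : in_Ipow d f -> in_Ipow d g -> in_Ipow d (f + g)
| IpowJ d (f g : Aw n) : in_J (f - g) -> in_Ipow d g -> in_Ipow d f.

(* Free algebra on symbols X_ij (one per generator) and the graded    *)
(* algebra map  Q<X_ij> -> gr_I Q PvB_n,  X_ij |-> class of R_ij - 1   *)
(* in I/I^2.  A homogeneous p of degree d is sent to the class of     *)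
(* lift p in I^d/I^(d+1).                                             *)

Definition Bx (n : nat) := {malg rat[{fmonom (gen n)}]}.

Definition lift_mon (n : nat) (m : {fmonom (gen n)}) : Aw n :=
  \prod_(a <- fmonom_val m) (wd [:: pos a] - 1).

Definition lift (n : nat) (p : Bx n) : Aw n :=
  \sum_(m <- msupp p) p@_m *: lift_mon m.

Definition homog (n : nat) (d : nat) (p : Bx n) : Prop :=
  forall m : {fmonom (gen n)}, m \in msupp p -> size (fmonom_val m) = d.

(* degree-d component of the kernel of Q<X> -> gr_I Q PvB_n *)
Definition in_ker (n : nat) (d : nat) (p : Bx n) : Prop :=
  homog d p /\ in_Ipow d.+1 (lift p).

Inductive in_ideal (n : nat) (S : Bx n -> Prop) : Bx n -> Prop :=
| ideal_gen s : S s -> in_ideal S s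
| ideal0 : in_ideal S 0
| idealD x y : in_ideal S x -> in_ideal S y -> in_ideal S (x + y)
| idealM a x b : in_ideal S x -> in_ideal S (a * x * b).

(* gr_I Q PvB_n is quadratic:
   (1) it is generated by degree 1 (the map Q<X> -> gr is onto in every
       degree), and
   (2) the ideal of relations (kernel of Q<X> -> gr) is generated by its
       components of degree <= 2 (equivalent to the kernel
       of TV -> gr being generated by its degree-2 part R). *)
Definition pvb_quadratic (n : nat) : Prop :=
  (forall (d : nat) (f : Aw n), in_Ipow d f ->
      exists p : Bx n, homog d p /\ in_Ipow d.+1 (f - lift p))
  /\
  (forall (d : nat) (p : Bx n), in_ker d p ->
      in_ideal (fun q => in_ker 1 q \/ in_ker 2 q) p).

(* Main.v *)
(* Take as letters r_ij and r_ij + r_ji for i < j, where r_ij stands for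
   R_ij - 1, and give both the weight M + i + j.  Suitable combinations of the
   defining relations of PvB_n, and of their quadratic parts, then have as
   lightest term a commutator of two letters, so that both the quadratic
   algebra and the graded group ring are compared with the algebra of one and
   the same partially commutative monoid.

   Upper bound: modulo the quadratic relations, every element of degree d is a
   combination q of normal words of length d of this monoid.

   Lower bound: there are functionals on the free algebra that vanish on the
   relations of PvB_n and on very heavy words and take arbitrary values on the
   normal words; if q represents 0 in I^d / I^(d+1) they force q = 0.  Such a
   functional is built by decreasing weight: each relation prescribes how it
   changes when two commuting letters are swapped, and the only obstruction to
   integrating these prescriptions is the hexagon attached to three pairwise
   commuting letters.  This obstruction vanishes because of the identity among
   relations behind Zamolodchikov's tetrahedron equation: R12 R13 R14 R23 R24
   R34 can be reversed in two ways. *)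

Require Import Defs.
From HB Require Import structures.
From mathcomp Require Import all_boot all_order all_algebra.
From mathcomp Require Import finmap.
From mathcomp.multinomials Require Import monalg.
From mathcomp Require Import zify ring lra.
From Stdlib Require Ncring Ncring_tac.

Set Implicit Arguments.
Unset Strict Implicit.
Unset Printing Implicit Defensive.

Import GRing.Theory.
Local Open Scope ring_scope.

(** * Free algebras *)

(** On three indices i < j < k there are six letters, and exactly six pairs of them commute in the
    monoid: as many as there are Yang-Baxter relations on the triple. The combinations chosen below
    are an invertible change of basis between the two, so that no relation is lost. The sum r_jk +
    r_kj has to be a letter because the relations for (i,j,k) and (i,k,j) add up to an expression
    with lightest part [r_ij, r_jk + r_kj]. The obstacle in the group ring is that its relations are
    not homogeneous: the Yang-Baxter relation has a cubic part, and the inverse of 1 + r is an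
    infinite series. Both are tamed by a large constant M in the weights, which makes every extra
    factor outweigh all differences of indices, and by cutting off at a weight that no word of
    length d reaches. Weights also localise the consistency check. Two swaps at separate places
    agree by relations that are heavier, hence already imposed. Of the hexagons, those in which one
    letter shares no index with the other two follow from the Jacobi identity, and the rest involve
    only four indices. *)

Section LinearExtension.
Context (K : choiceType) (V : lmodType rat) (f : K -> V).

Definition ext (p : {malg rat[K]}) : V := \sum_(k <- msupp p) p@_k *: f k.

Lemma extEw (d : {fset K}) p :
  (msupp p `<=` d)%fset -> ext p = \sum_(k <- d) p@_k *: f k.
Proof.
move=> le; rewrite /ext (big_fset_incl _ le) // => x _ /mcoeff_outdom ->.
by rewrite scale0r.
Qed.

Lemma ext_is_linear : linear ext.
Proof.
move=> c p q; pose d := (msupp p `|` msupp q)%fset.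
rewrite !(@extEw d) ?fsubsetUl ?fsubsetUr //; last first.
  apply: (fsubset_trans (msuppD_le _ _)).
  by rewrite fsetUSS // ?msuppZ_le.
rewrite scaler_sumr -big_split; apply: eq_bigr => k _.
by rewrite mcoeffD mcoeffZ scalerDl scalerA.
Qed.

HB.instance Definition _ :=
  GRing.isLinear.Build rat {malg rat[K]} V *:%R ext ext_is_linear.

Lemma extU k : ext << k >> = f k.
Proof. by rewrite (extEw msuppU_le) big_seq_fset1 mcoeffUU scale1r. Qed.
End LinearExtension.

Lemma malgZU (K : choiceType) c d (k : K) :
  c *: << d *g k >> = << c * d *g k >> :> {malg rat[K]}.
Proof. by apply/malgP => k'; rewrite mcoeffZ !mcoeffU mulrnAr. Qed.

Lemma malg_sum (K : choiceType) (p : {malg rat[K]}) :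
  p = \sum_(k <- msupp p) p@_k *: << k >>.
Proof.
by rewrite {1}[p]monalgE; apply: eq_bigr => k _; rewrite malgZU mulr1.
Qed.

Lemma malg_scalerAr (K : monomType) c (p q : {malg rat[K]}) :
  c *: (p * q) = p * (c *: q).
Proof.
rewrite -!mul_malgC mulrA mulrA; congr (_ * _).
rewrite [p]monalgE mulr_sumr mulr_suml; apply: eq_bigr => k _.
by rewrite !malgM_def [LHS]fgmulUU [RHS]fgmulUU mul1m mulm1 mulrC.
Qed.

Definition fa (T : choiceType) := {malg rat[{fmonom T}]}.

HB.instance Definition _ (T : choiceType) := GRing.Lalgebra.on (fa T).
HB.instance Definition _ (T : choiceType) :=
  GRing.Lalgebra_isAlgebra.Build rat (fa T) (@malg_scalerAr _).

HB.lock Definition fword (T : choiceType) (w : seq T) : fa T := << FMonom w >>.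
Canonical fword_unlockable := Unlockable fword.unlock.

Section FreeAlgebra.
Context (T : choiceType).

Lemma fword0 : fword [::] = 1 :> fa T.
Proof. by rewrite unlock -fmoneE. Qed.

Lemma fwordM u v : fword (u ++ v) = fword u * fword v :> fa T.
Proof.
rewrite unlock malgM_def [RHS]fgmulUU mulr1; congr (mkmalgU _ _).
exact/esym/fmmulE.
Qed.

Lemma fa_ind (P : fa T -> Prop) : P 0 ->
  (forall c p q, P p -> P q -> P (c *: p + q)) ->
  (forall w, P (fword w)) -> forall p, P p.
Proof.
move=> P0 PD Pw p; rewrite [p]malg_sum; apply: big_ind => //.
  by move=> x y Px Py; rewrite -[x]scale1r; apply: PD.
move=> [m] _; rewrite -[_ *: _]addr0; apply: PD => //.
by have := Pw m; rewrite unlock.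
Qed.

Section Functional.
Context (V : lmodType rat) (f : seq T -> V).
Definition linext : fa T -> V := ext (fun m : {fmonom T} => f m).
HB.instance Definition _ := GRing.Linear.on linext.
Lemma linext_word w : linext (fword w) = f w.
Proof. by rewrite /linext unlock extU. Qed.
End Functional.

Section Hom.
Context (A : algType rat) (f : T -> A).

Definition free_hom : fa T -> A := linext (fun w => \prod_(a <- w) f a).

HB.instance Definition _ := GRing.Linear.on free_hom.

Lemma free_hom_word w : free_hom (fword w) = \prod_(a <- w) f a.
Proof. exact: linext_word. Qed.

Lemma free_hom_multiplicative : monoid_morphism free_hom.
Proof.
have hD c x y : free_hom (c *: x + y) = c *: free_hom x + free_hom y by exact: linearP.
split=> [|p q]; first by rewrite -fword0 free_hom_word big_nil.
elim/fa_ind: p => [|c p p' IH IH'|u]; first by rewrite mul0r linear0 mul0r.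
  by rewrite hD mulrDl -(scalerAl c p q) hD mulrDl -scalerAl; congr (_ *: _ + _).
elim/fa_ind: q => [|c q q' IH IH'|v]; first by rewrite mulr0 linear0 mulr0.
  by rewrite hD mulrDr -(scalerAr c _ q) hD mulrDr -scalerAr; congr (_ *: _ + _).
by rewrite -fwordM !free_hom_word big_cat.
Qed.

HB.instance Definition _ :=
  GRing.isMonoidMorphism.Build (fa T) A free_hom free_hom_multiplicative.
End Hom.
End FreeAlgebra.

(** * Functions with prescribed increments on a partially commutative monoid *)

Section Trace.
Context (T : finType) (comm : rel T).
Implicit Types (a b c : T) (u v w x y : seq T).

(** Tests whether swaps can carry the first [a] of [w] to its head. *)
Fixpoint front a w : bool :=
  if w is b :: w' then (b == a) || comm a b && front a w' else false.

(** The choice depends only on the set of letters that can come first, which swaps preserve. It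
    takes the first of them in the enumeration of [T], so [nf] is a lexicographic normal form. *)
Definition head_letter w : option T := [pick a | front a w].

Fixpoint nf_rec k w : seq T :=
  if k isn't k'.+1 then w else
  if head_letter w is Some a then a :: nf_rec k' (rem a w) else w.

(* a representative of the class of [w] under swaps of adjacent commuting letters *)
Definition nf w := nf_rec (size w) w.

Lemma nf_recS k w a : head_letter w = Some a ->
  nf_rec k.+1 w = a :: nf_rec k (rem a w).
Proof. by move=> /= ->. Qed.

Lemma frontP a w : reflect
  (exists u v, [/\ w = u ++ a :: v, a \notin u & all (comm a) u]) (front a w).
Proof.
elim: w => [|b w IH] /=; first by constructor=> -[[|? ?] [? []]].
have [->|neq_ba] := eqVneq b a; first by constructor; exists [::], w.
have [cab|ncab] /= := boolP (comm a b); last first.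
  constructor=> -[[|c u] [v [[e1 e2]]]]; first by rewrite e1 eqxx in neq_ba.
  by move=> _ /andP[]; rewrite -e1 (negPf ncab).
apply: (iffP IH) => [[u [v [-> nau au]]]|].
  by exists (b :: u), v; rewrite /= cab au inE eq_sym negb_or neq_ba nau.
move=> [[|c u] [v [[e1 ->]]]]; first by rewrite e1 eqxx in neq_ba.
by rewrite inE negb_or => /andP[_ nau] /andP[_ au]; exists u, v.
Qed.

Lemma rem_notin a u v : a \notin u -> rem a (u ++ a :: v) = u ++ v.
Proof.
elim: u => [|b u IH] /=; first by rewrite eqxx.
by rewrite inE negb_or eq_sym => /andP[/negPf-> /IH->].
Qed.

Lemma head_letter_cons b w : exists a, head_letter (b :: w) = Some a.
Proof.
rewrite /head_letter; case: pickP => [a _|/(_ b)]; first by exists a.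
by rewrite /= eqxx.
Qed.

Lemma head_letter_front w a : head_letter w = Some a -> front a w.
Proof. by rewrite /head_letter; case: pickP => // b fb [<-]. Qed.

Hypothesis comm_sym : symmetric comm.
Hypothesis comm_irr : irreflexive comm.

Lemma front_swap a x b c y :
  comm b c -> front a (x ++ b :: c :: y) = front a (x ++ c :: b :: y).
Proof.
move=> cbc; elim: x => [|d x IH] /=; last by rewrite IH.
have [eba|_] := eqVneq b a; have [eca|_] := eqVneq c a => //=.
- by rewrite -eba cbc.
- by rewrite -eca comm_sym cbc.
- by case: (comm a b); case: (comm a c).
Qed.

Lemma head_letter_swap x b c y :
  comm b c -> head_letter (x ++ b :: c :: y) = head_letter (x ++ c :: b :: y).
Proof. by move=> cbc; apply: eq_pick => a; apply: front_swap. Qed.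

Lemma front_cat a u w : a \notin u -> front a (u ++ w) = all (comm a) u && front a w.
Proof.
elim: u => //= b u IH; rewrite inE negb_or eq_sym => /andP[/negPf -> /IH ->].
by rewrite andbA.
Qed.

Lemma first_split a w : a \in w -> exists u v, w = u ++ a :: v /\ a \notin u.
Proof.
elim: w => //= b w IH; rewrite inE; have [->|nab] := eqVneq a b.
  by exists [::], w.
by move=> /IH [u [v [-> nau]]]; exists (b :: u), v; rewrite inE negb_or nab.
Qed.

Section Potential.
Implicit Types (d : seq T -> T -> T -> seq T -> rat).

(* [d u a b v] is the prescribed increment from [u b a v] to [u a b v]; the last
   two conditions are those of a square and of a hexagon of swaps *)
Definition cocycle d : Prop :=
  [/\ forall u a b v, comm a b -> d u a b v = - d u b a v,
      forall u a b v b' c' y, comm a b -> comm b' c' ->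
        d u a b (v ++ b' :: c' :: y) + d (u ++ b :: a :: v) b' c' y =
        d (u ++ a :: b :: v) b' c' y + d u a b (v ++ c' :: b' :: y)
    & forall u a b c v, comm a b -> comm a c -> comm b c ->
        d u a b (c :: v) + d (rcons u b) a c v + d u b c (a :: v) =
        d (rcons u a) b c v + d u a c (b :: v) + d (rcons u c) a b v].

(* the sum of the increments met when [a] travels to the left across [u] *)
Fixpoint move d (p u : seq T) (a : T) (v : seq T) : rat :=
  if u is c :: u' then move d (rcons p c) u' a v + d p c a (u' ++ v) else 0.

(** Value at [w] minus value at its normal form, for any function with increments [d]: the head
    letter is carried to the front, and the rest is sorted with that letter added to the left
    context. The fuel [k] is the length of [w]. *)
Fixpoint pot k d w : rat :=
  if k isn't k'.+1 then 0 else
  if head_letter w is Some a then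
    move d [::] (take (index a w) w) a (drop (index a w).+1 w)
    + pot k' (fun u => d (a :: u)) (rem a w)
  else 0.

Lemma move_rcons d p u c a v :
  move d p (rcons u c) a v = d (p ++ u) c a v + move d p u a (c :: v).
Proof.
elim: u p => [|e u IH] p /=; first by rewrite cats0 add0r addr0.
by rewrite IH !cat_rcons -addrA.
Qed.

(** The pair [b], [c] stays to the right of the travelling letter, so every step of the journey
    forms a square with the swap, and the squares telescope. *)
Lemma move_swap_right d p u a v b c y :
  cocycle d -> all (comm a) u -> comm b c ->
  move d p u a (v ++ b :: c :: y) - move d p u a (v ++ c :: b :: y) =
  d (p ++ u ++ a :: v) b c y - d (p ++ a :: u ++ v) b c y.
Proof.
move=> cd + cbc; elim: u p => [|e u IH] p /=; first by rewrite !subrr.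
case/andP=> cae au; have [_ sq _] := cd.
have := sq p e a (u ++ v) b c y; rewrite comm_sym cae => /(_ isT cbc).
have := IH (rcons p e) au; rewrite !cat_rcons -?catA /=.
by move=> h1 h2; lra.
Qed.

Lemma move_swap_prefix d p u a v b c :
  cocycle d -> all (comm a) u -> comm b c ->
  forall p', move d (p ++ b :: c :: p') u a v - move d (p ++ c :: b :: p') u a v =
  d p b c (p' ++ u ++ a :: v) - d p b c (p' ++ a :: u ++ v).
Proof.
move=> cd + cbc; elim: u => [|e u IH] /=; first by move=> *; rewrite !subrr.
case/andP=> cae au p'; have [_ sq _] := cd.
have := sq p b c p' e a (u ++ v) cbc; rewrite comm_sym cae => /(_ isT).
have := IH au (rcons p' e); rewrite !rcons_cat /= !cat_rcons.
by move=> h1 h2; lra.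
Qed.

Lemma move_swap_left d p u b c u' a v :
  cocycle d -> all (comm a) (u ++ b :: c :: u') -> comm b c ->
  move d p (u ++ b :: c :: u') a v - move d p (u ++ c :: b :: u') a v =
  d (p ++ u) b c (u' ++ a :: v) - d (p ++ a :: u) b c (u' ++ v).
Proof.
move=> cd + cbc; elim: u p => [|e u IH] p /=.
  (* The hexagon enters here, where [a] crosses both letters of the swapped pair; all other steps
     are squares. *)
  case/and3P=> cab cac au'; have [an _ hx] := cd.
  have := @move_swap_prefix d p u' a v b c cd au' cbc [::].
  have := hx p b c a (u' ++ v) cbc; rewrite ![comm _ a]comm_sym cab cac => /(_ isT isT).
  have := an (rcons p a) b c (u' ++ v) cbc.
  rewrite -!cats1 -?catA /= cats0 => h1 h2 h3; lra.
case/andP=> cae au; have [_ sq _] := cd.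
have := sq p e a u b c (u' ++ v); rewrite comm_sym cae => /(_ isT cbc).
have := IH (rcons p e) au; rewrite !cat_rcons -?catA /=.
by move=> h1 h2; lra.
Qed.

Lemma cocycle_cons d a : cocycle d -> cocycle (fun u => d (a :: u)).
Proof.
case=> an sq hx; split=> [u b c v|u b c v b' c' y|u b c e v].
- exact: an.
- exact: sq (a :: u) _ _ _ _ _ _.
- exact: hx (a :: u) _ _ _ _.
Qed.

Lemma pot_split d k w a u v : head_letter w = Some a -> w = u ++ a :: v ->
  a \notin u ->
  pot k.+1 d w = move d [::] u a v + pot k (fun u => d (a :: u)) (u ++ v).
Proof.
move=> e ew nau /=; rewrite e ew rem_notin //.
have -> : index a (u ++ a :: v) = size u.
  by rewrite index_cat (negPf nau) /= eqxx addn0.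
rewrite take_size_cat // -cat_rcons drop_size_cat ?size_rcons //.
Qed.

Lemma pot_nf d k w : size w = k -> nf_rec k w = w -> pot k d w = 0.
Proof.
elim: k d w => [|k IH] d [|b w] // sw.
have [a e] := head_letter_cons b w; rewrite /= in sw.
move=> /= ; rewrite e => -[eab ew].
subst b; rewrite eqxx /= in ew *.
by rewrite ?drop0 add0r IH //; case: sw.
Qed.

Arguments pot : simpl never.

(** Independence of the path. Both words have the same head letter [a], which is left of the swapped
    pair, equal to [b], equal to [c], or right of the pair. In the two middle cases the sorting
    paths differ by the swap itself; only in the last does [a] cross the pair. *)
Lemma pot_swap d k x b c y : cocycle d -> comm b c ->
  size (x ++ b :: c :: y) = k ->
  pot k d (x ++ b :: c :: y) - pot k d (x ++ c :: b :: y) = d x b c y.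
Proof.
elim: k d x y => [|k IH] d x y cd cbc; first by rewrite size_cat addnC.
move=> sk; have [a ha] : exists a, head_letter (x ++ b :: c :: y) = Some a.
  by case: (x) => *; apply: head_letter_cons.
have ha' := ha; rewrite head_letter_swap // in ha'.
have fr := head_letter_front ha; have [an _ _] := cd.
have [/first_split [x1 [x2 [ex nax]]]|nax] := boolP (a \in x).
  move: fr ha ha' sk; rewrite ex -?catA front_cat //= => /andP[ax _] ha ha' sk.
  rewrite (pot_split _ _ ha erefl nax) (pot_split _ _ ha' erefl nax).
  have := IH _ (x1 ++ x2) y (cocycle_cons a cd) cbc.
  have := @move_swap_right d [::] x1 a x2 b c y cd ax cbc.
  rewrite -?catA /= => h1 h2; have {}h2 : _ := h2 _.
  move: sk; rewrite !size_cat /= !size_cat /= => sk.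
  rewrite !size_cat /= in h2; have := h2 ltac:(lia); lra.
have [eab|nab] := eqVneq a b.
  subst a; move: fr; rewrite front_cat //= eqxx andbT => ax.
  rewrite (pot_split _ _ ha erefl nax).
  rewrite (@pot_split _ _ _ _ (rcons x c) y ha') ?cat_rcons //; last first.
    rewrite mem_rcons inE negb_or nax andbT.
    by apply: contraTneq cbc => ->; rewrite comm_irr.
  by rewrite move_rcons /= (an x b c) //; lra.
have [eac|nac] := eqVneq a c.
  subst a; rewrite (pot_split _ _ ha' erefl nax).
  rewrite (@pot_split _ _ _ _ (rcons x b) y ha) ?cat_rcons //; last first.
    by rewrite mem_rcons inE negb_or nax andbT.
  by rewrite move_rcons /=; lra.
move: fr; rewrite front_cat //= ![_ == a]eq_sym (negPf nab) (negPf nac) /=.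
case/and4P=> ax cab cac /frontP [y1 [y2 [ey nay ay]]]; subst y.
have nau z t : z \in [:: b; c] -> t \in [:: b; c] -> a \notin x ++ z :: t :: y1.
  rewrite !inE mem_cat !inE !negb_or nax nay.
  by move=> /orP[]/eqP-> /orP[]/eqP->; rewrite ?nab ?nac.
rewrite (@pot_split _ _ _ _ (x ++ b :: c :: y1) y2 ha) -?catA //; last first.
  by apply: nau; rewrite !inE eqxx ?orbT.
rewrite (@pot_split _ _ _ _ (x ++ c :: b :: y1) y2 ha') -?catA //; last first.
  by apply: nau; rewrite !inE eqxx ?orbT.
have := IH _ x (y1 ++ y2) (cocycle_cons a cd) cbc.
have au : all (comm a) (x ++ b :: c :: y1) by rewrite all_cat /= ax cab cac.
have := @move_swap_left d [::] x b c y1 a y2 cd au cbc.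
move: sk; rewrite !size_cat /= !size_cat /= => sk h1 h2.
have := h2 ltac:(lia); lra.
Qed.

Lemma nf_rec_swap k x b c y : comm b c -> size (x ++ b :: c :: y) = k ->
  nf_rec k (x ++ b :: c :: y) = nf_rec k (x ++ c :: b :: y).
Proof.
elim: k x y => [|k IH] x y cbc; first by rewrite size_cat addnC.
move=> sk; have [a ha] : exists a, head_letter (x ++ b :: c :: y) = Some a.
  by case: (x) => *; apply: head_letter_cons.
have fr := head_letter_front ha.
rewrite (nf_recS _ ha); rewrite head_letter_swap // in ha.
rewrite (nf_recS _ ha); congr (_ :: _).
have [/first_split [x1 [x2 [ex nax]]]|nax] := boolP (a \in x).
  move: sk; rewrite ex -?catA /= !rem_notin // !size_cat /= size_cat /= => sk.
  by rewrite !catA IH // !size_cat /=; lia.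
have [eab|nab] := eqVneq a b.
  subst a; rewrite -(cat_rcons c) !rem_notin ?cat_rcons //.
  rewrite mem_rcons inE negb_or nax andbT.
  by apply: contraTneq cbc => ->; rewrite comm_irr.
have [eac|nac] := eqVneq a c.
  subst a; rewrite -(cat_rcons b) !rem_notin ?cat_rcons //.
  by rewrite mem_rcons inE negb_or nax andbT.
move: fr; rewrite front_cat //= ![_ == a]eq_sym (negPf nab) (negPf nac) /=.
case/and4P=> _ _ _ /frontP [y1 [y2 [ey nay _]]]; subst y.
have E z t : z \in [:: b; c] -> t \in [:: b; c] ->
    rem a (x ++ z :: t :: y1 ++ a :: y2) = x ++ z :: t :: y1 ++ y2.
  move=> hz ht; have := @rem_notin a (x ++ z :: t :: y1) y2.
  rewrite -?catA /=; apply; move: hz ht.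
  rewrite !inE mem_cat !inE !negb_or nax nay.
  by move=> /orP[]/eqP-> /orP[]/eqP->; rewrite ?nab ?nac.
rewrite !E ?inE ?eqxx ?orbT // IH //.
by move: sk; rewrite !size_cat /= !size_cat /=; lia.
Qed.

Lemma nf_swap x b c y : comm b c ->
  nf (x ++ b :: c :: y) = nf (x ++ c :: b :: y).
Proof.
move=> cbc; rewrite /nf nf_rec_swap //.
by congr (nf_rec _ _); rewrite !size_cat.
Qed.

Theorem potential d (base : seq T -> rat) : cocycle d -> exists f : seq T -> rat,
  (forall u a b v, comm a b -> f (u ++ a :: b :: v) - f (u ++ b :: a :: v) = d u a b v)
  /\ forall w, nf w = w -> f w = base w.
Proof.
move=> cd; exists (fun w => base (nf w) + pot (size w) d w); split=> [u a b v cab|w nw].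
  rewrite nf_swap // [size (u ++ b :: _)]size_cat.
  have -> : (size u + size (b :: a :: v))%N = size (u ++ a :: b :: v).
    by rewrite size_cat.
  by rewrite -(pot_swap cd cab erefl); lra.
by rewrite nw pot_nf // addr0.
Qed.
End Potential.

(** Stated for any reflexive and transitive relation, since [reduce] applies it to one that carries
    correction terms along the swaps. *)
Lemma nf_ind (P : seq T -> seq T -> Prop) :
  (forall w, P w w) -> (forall w1 w2 w3, P w1 w2 -> P w2 w3 -> P w1 w3) ->
  (forall u a b v, comm a b -> P (u ++ a :: b :: v) (u ++ b :: a :: v)) ->
  forall w, P w (nf w).
Proof.
move=> Pr Pt Ps.
have mv p u a v : all (comm a) u -> P (p ++ u ++ a :: v) (p ++ a :: u ++ v).
  elim: u p => [|e u IH] p //= /andP[cae au].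
  have := IH (rcons p e) au; rewrite !cat_rcons => h; apply: Pt h _.
  by apply: Ps; rewrite comm_sym.
suff h k p w : size w = k -> P (p ++ w) (p ++ nf_rec k w).
  by move=> w; apply: (h _ [::]).
elim: k p w => [|k IH] p [|b w] // [sw].
have [a e] := head_letter_cons b w; rewrite (nf_recS _ e).
have /head_letter_front/frontP[u [v [ew nau au]]] := e.
have -> : rem a (b :: w) = u ++ v by rewrite ew rem_notin.
rewrite ew; apply: (Pt _ _ _ (mv p u a v au)).
rewrite -cat_rcons -(cat_rcons a p); apply: IH.
by move/(congr1 size): ew; rewrite /= !size_cat /=; lia.
Qed.

Lemma nf_idem w : nf (nf w) = nf w.
Proof.
apply: (@nf_ind (fun w w' => nf w' = nf w)) => // [u v x h1 h2|u a b v cab].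
  by rewrite h2.
by rewrite nf_swap // comm_sym.
Qed.
End Trace.

(** * Functionals that vanish on deformed commutation relations *)

Definition mul3 (B : algType rat) (u v p : B) : B := u * p * v.

Lemma mul3_is_linear (B : algType rat) (u v : B) : linear (mul3 u v).
Proof. by move=> c p q; rewrite /mul3 mulrDr mulrDl -scalerAr -scalerAl. Qed.

HB.instance Definition _ (B : algType rat) (u v : B) :=
  GRing.isLinear.Build rat B B *:%R (mul3 u v) (mul3_is_linear u v).

(* [B] is the free algebra on [T], with basis the words [mon w]; it is kept
   abstract because unification in the concrete free algebra is too slow. *)
Section PBW.
Context (T : finType) (B : algType rat) (mon : seq T -> B).
Hypothesis mon0 : mon [::] = 1.
Hypothesis monM : forall u v, mon (u ++ v) = mon u * mon v.
Hypothesis mon_lin : forall f : seq T -> rat,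
  exists g : {linear B -> rat^o}, forall w, g (mon w) = f w.
Context (wt : T -> nat).
Implicit Types (u v w : seq T) (p q : B) (G : {linear B -> rat^o}).

Definition letx a : B := mon [:: a].
Local Notation x := letx.

Lemma mon_cons a v : mon (a :: v) = x a * mon v.
Proof. by rewrite -monM. Qed.

Definition wwt w : nat := sumn (map wt w).

Lemma wwt_cat u v : wwt (u ++ v) = (wwt u + wwt v)%N.
Proof. by rewrite /wwt map_cat sumn_cat. Qed.

Lemma wwt_cons a w : wwt (a :: w) = (wt a + wwt w)%N.
Proof. by []. Qed.

Lemma wwt_nil : wwt [::] = 0%N.
Proof. by []. Qed.

Definition wwtE := (wwt_cat, wwt_cons, wwt_nil).

Section Span.
Variable Q : pred (seq T).

Inductive span : B -> Prop :=
| span0 : span 0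
| span_add c w p : Q w -> span p -> span (c *: mon w + p).

Lemma spanD p q : span p -> span q -> span (p + q).
Proof.
move=> Sp Sq; elim: Sp => [|c w p' Qw _ IH]; first by rewrite add0r.
by rewrite -addrA; apply: span_add.
Qed.

Lemma spanZ c p : span p -> span (c *: p).
Proof.
elim=> [|c' w p' Qw _ IH]; first by rewrite scaler0; apply: span0.
by rewrite scalerDr scalerA; apply: span_add.
Qed.

Lemma spanN p : span p -> span (- p).
Proof. by rewrite -scaleN1r; apply: spanZ. Qed.

Lemma spanB p q : span p -> span q -> span (p - q).
Proof. by move=> Sp Sq; apply: spanD => //; apply: spanN. Qed.

Lemma span_mon w : Q w -> span (mon w).
Proof.
by move=> Qw; rewrite -[mon w]addr0 -[mon w]scale1r; apply: span_add => //; apply: span0.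
Qed.
End Span.

Lemma span_sub (Q Q' : pred (seq T)) p : subpred Q Q' -> span Q p -> span Q' p.
Proof.
move=> QQ'; elim=> [|c w p' Qw _ IH]; first exact: span0.
by apply: span_add => //; apply: QQ'.
Qed.

Lemma spanM (Q1 Q2 Q : pred (seq T)) p q :
  (forall u v, Q1 u -> Q2 v -> Q (u ++ v)) -> span Q1 p -> span Q2 q -> span Q (p * q).
Proof.
move=> QQ Sp Sq; elim: Sp => [|c w p' Qw _ IH]; first by rewrite mul0r; apply: span0.
rewrite mulrDl; apply: spanD IH; rewrite -scalerAl; apply: spanZ.
elim: Sq => [|c' w' q' Qw' _ IH]; first by rewrite mulr0; apply: span0.
rewrite mulrDr; apply: spanD IH; rewrite -scalerAr; apply: spanZ.
by rewrite -monM; apply/span_mon/QQ.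
Qed.

Definition heavy (D : pred T) k : pred (seq T) := fun w => all D w && (k <= wwt w)%N.
Definition homw (D : pred T) d k : pred (seq T) := fun w => heavy D k w && (size w == d).
Definition wspan D k := span (heavy D k).
Definition wspand D d k := span (homw D d k).
Local Notation W := wspan.
Local Notation Wd := wspand.

Lemma W_mon (D : pred T) k w : all D w -> (k <= wwt w)%N -> W D k (mon w).
Proof. by move=> Dw kw; apply: span_mon; rewrite /heavy Dw. Qed.

Lemma W_weak D j k p : (j <= k)%N -> W D k p -> W D j p.
Proof.
move=> jk; apply: span_sub => w /andP[Dw kw].
by rewrite /heavy Dw; apply: leq_trans kw.
Qed.

Lemma WM D j k p q : W D j p -> W D k q -> W D (j + k) (p * q).
Proof.
apply: spanM => u v /andP[Du ju] /andP[Dv kv].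
by rewrite /heavy all_cat Du Dv wwt_cat leq_add.
Qed.

Lemma W_sub (D D' : pred T) k p : subpred D D' -> W D k p -> W D' k p.
Proof.
move=> DD'; apply: span_sub => w /andP[Dw kw].
by rewrite /heavy kw andbT; apply: sub_all Dw.
Qed.

Lemma Wd_weak D d j k p : (j <= k)%N -> Wd D d k p -> Wd D d j p.
Proof.
move=> jk; apply: span_sub => w /andP[/andP[Dw kw] sw].
by rewrite /homw /heavy Dw sw (leq_trans jk kw).
Qed.

Lemma WdM D d e j k p q : Wd D d j p -> Wd D e k q -> Wd D (d + e) (j + k) (p * q).
Proof.
apply: spanM => u v /andP[/andP[Du ju] /eqP <-] /andP[/andP[Dv kv] /eqP <-].
by rewrite /homw /heavy all_cat Du Dv wwt_cat leq_add //= size_cat.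
Qed.

Lemma Wd_W D d k p : Wd D d k p -> W D k p.
Proof. by apply: span_sub => w /andP[]. Qed.

Context (comm : rel T) (h : T -> T -> B).
Hypothesis comm_sym : symmetric comm.
Hypothesis comm_irr : irreflexive comm.

Definition crel a b : B := x a * x b - x b * x a - h a b.

(** The threshold [k] allows the relations to be imposed one weight at a time, the heaviest
    first. *)
Definition kills k G : Prop := forall a b u v, comm a b ->
  (k <= wwt u + (wt a + wt b) + wwt v)%N -> G (mon u * crel a b * mon v) = 0.

Lemma killsE D k G a b i j p q : kills k G -> comm a b -> W D i p -> W D j q ->
  (k <= i + (wt a + wt b) + j)%N -> G (p * crel a b * q) = 0.
Proof.
move=> Gk cab Wp Wq ij; elim: Wp => [|c w p' /andP[_ iw] _ IH].
  by rewrite !mul0r linear0.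
rewrite !mulrDl -!scalerAl linearP /= IH addr0.
elim: Wq => [|c' w' q' /andP[_ jw'] _ IH']; first by rewrite mulr0 linear0 scaler0.
rewrite mulrDr -scalerAr linearP scalerDr /= IH' addr0.
by rewrite Gk ?scaler0 //; lia.
Qed.

(** The relations in it start at weight [wt a + wt b + wt c], but the Jacobi identity cancels all
    products of three letters and leaves terms in [h], which are heavier. Its vanishing is thus a
    condition on values fixed before that weight is reached: the closing of the hexagon. *)
Definition jacobiator a b c : B :=
  (crel a b * x c - x c * crel a b) + (crel b c * x a - x a * crel b c)
  + (crel c a * x b - x b * crel c a).

Local Notation jacobi := jacobiator.

Hypothesis h_anti : forall a b, comm a b -> h b a = - h a b.
Hypothesis h_W : forall a b, comm a b -> W predT (wt a + wt b).+1 (h a b).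
Hypothesis jacobi_vanish : forall G a b c, comm a b -> comm a c -> comm b c ->
  kills (wt a + wt b + wt c).+1 G -> G (jacobi a b c) = 0.

Lemma G_jacobi G a b c : comm a c -> G (jacobi a b c) =
  - (G (h a b * x c) + G (x b * h a c) + G (h b c * x a)
     - G (x a * h b c) - G (h a c * x b) - G (x c * h a b)).
Proof.
move=> cac; rewrite /jacobi /crel (h_anti cac).
rewrite !(mulrDl, mulrDr, mulrN, mulNr, opprD, opprK, mulrA).
rewrite !(linearD, linearN) /=; lra.
Qed.

Lemma W_rel a b : comm a b -> W predT (wt a + wt b) (crel a b).
Proof.
move=> cab; rewrite /crel /x -!monM; apply: spanB; first apply: spanB.
- by apply: W_mon; rewrite ?all_predT // !wwtE; lia.
- by apply: W_mon; rewrite ?all_predT // !wwtE; lia.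
- by apply: W_weak (h_W cab).
Qed.

Lemma W_eq D k G G' : (forall w, (k <= wwt w)%N -> G (mon w) = G' (mon w)) ->
  forall p, W D k p -> G p = G' p.
Proof.
move=> e p; elim=> [|c w p' /andP[_ kw] _ IH]; first by rewrite !linear0.
by rewrite !linearP /= e // IH.
Qed.

Lemma W_mon3 k p u v : W predT k p -> W predT (wwt u + k + wwt v) (mon u * p * mon v).
Proof.
by move=> Wp; apply: WM; first apply: WM => //; apply: W_mon; rewrite ?all_predT.
Qed.

Section Step.
Variables (m : nat) (G : {linear B -> rat^o}).
Hypothesis Gk : kills m.+1 G.

(** The change under a swap that makes the relation vanish at weight [m]. It is known beforehand,
    since [h a b] is heavier than the two letters. *)
Definition incr u a b v : rat :=
  if comm a b && (wwt u + (wt a + wt b) + wwt v == m)%N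
  then G (mon u * h a b * mon v) else 0.

Lemma incr_cocycle : cocycle comm incr.
Proof.
split=> [u a b v cab|u a b v b' c' y cab cbc|u a b c v cab cac cbc].
- rewrite /incr (comm_sym b) cab (addnC (wt b)); case: ifP => _; last by rewrite oppr0.
  by rewrite (h_anti cab) mulrN mulNr linearN opprK.
- rewrite /incr cab cbc !wwtE /=.
  have [e|ne] := eqVneq (wwt u + (wt a + wt b) +
    (wwt v + (wt b' + (wt c' + wwt y))))%N m; last first.
    by rewrite !ifN ?addr0 //; apply: contraNneq ne => <-; lia.
  rewrite !ifT; try by apply/eqP; rewrite -e; lia.
  have Wv : W predT (wwt v + (wt b' + wt c').+1 + wwt y) (mon v * h b' c' * mon y).
    exact: W_mon3 (h_W cbc).
  have Wu : W predT (wwt u + (wt a + wt b).+1 + wwt v) (mon u * h a b * mon v).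
    exact: W_mon3 (h_W cab).
  have Wm w : W predT (wwt w) (mon w) by apply: W_mon; rewrite ?all_predT.
  (* Each of the two relations stands beside the factor [h] of the other pair, so it has weight
     above [m] and is already killed. *)
  have := killsE Gk cab (Wm u) Wv ltac:(lia).
  have := killsE Gk cbc Wu (Wm y) ltac:(lia).
  rewrite !monM !mon_cons /crel !(mulrBr, mulrBl, mulrA) !linearB /=.
  move=> h1 h2; lra.
- rewrite /incr cab cac cbc -!cats1 !wwtE /=.
  have [e|ne] := eqVneq (wwt u + (wt a + wt b) + (wt c + wwt v))%N m; last first.
    by rewrite !ifN ?addr0 //; apply: contraNneq ne => <-; lia.
  rewrite !ifT; try by apply/eqP; rewrite -e; lia.
  (* Absorbing the outer words into the functional lowers the threshold by their weights, down to
     the one required for the bare triple. *)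
  have Gk3 : kills (wt a + wt b + wt c).+1 (G \o mul3 (mon u) (mon v)).
    move=> a' b' u' v' cab' kw; rewrite /= /mul3 !mulrA -monM -mulrA -monM.
    by apply: Gk => //; rewrite !wwtE; lia.
  have := jacobi_vanish cab cac cbc Gk3; rewrite G_jacobi // /= /mul3.
  rewrite !monM !mon_cons mon0 !mulr1 !mulrA; lra.
Qed.
End Step.

(** Downward induction on the weight, from the zero functional at [k0]. The step to weight [m]
    changes [G] only on words of weight at most [m]; the values at weight [m] come from a potential
    whose increments are read off from heavier words, and its values on normal words are free. *)
Theorem pbw k0 (base : seq T -> rat) : exists G,
  [/\ forall w, (k0 <= wwt w)%N -> G (mon w) = 0, kills 0 G
    & forall w, nf comm w = w -> (wwt w < k0)%N -> G (mon w) = base w].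
Proof.
suff H k : (k <= k0)%N -> exists G,
  [/\ forall w, (k0 <= wwt w)%N -> G (mon w) = 0, kills (k0 - k) G
    & forall w, nf comm w = w -> (k0 - k <= wwt w < k0)%N -> G (mon w) = base w].
  by have [//|G] := H k0; rewrite subnn => -[h1 h2 h3]; exists G; split.
elim: k => [_|k IH kk0].
  have [G GE] := mon_lin (fun => 0); exists G; split=> [w _|a b u v cab _|w _].
  - exact: GE.
  - by rewrite (@W_eq predT 0 G \0) //; exact: W_weak (W_mon3 _ _ (W_rel cab)).
  - by rewrite subn0 => /andP[]; rewrite leqNgt => /negPf ->.
have [G [G1 G2 G3]] := IH (ltnW kk0); pose m := (k0 - k.+1)%N.
have em : (k0 - k = m.+1)%N by rewrite /m; lia.
rewrite em in G2 G3.
have [f [f1 f2]] := potential comm_sym comm_irr base (incr_cocycle G2).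
have [G' G'E] := mon_lin (fun w => if wwt w == m then f w else G (mon w)).
have GG' w : (m.+1 <= wwt w)%N -> G' (mon w) = G (mon w).
  by move=> mw; rewrite G'E gtn_eqF.
exists G'; split=> [w kw|a b u v cab|w nw].
- by rewrite GG' ?G1 //; lia.
- rewrite leq_eqVlt => /orP[/eqP ew|lw]; last first.
    rewrite (@W_eq predT m.+1 G' G) //; first exact: G2.
    exact: W_weak (W_mon3 _ _ (W_rel cab)).
  have Wh : W predT m.+1 (mon u * h a b * mon v).
    by apply: W_weak (W_mon3 _ _ (h_W cab)); lia.
  rewrite /crel /x !(mulrBr, mulrBl) -!mulrA -!monM !mulrA !linearB /=.
  rewrite (W_eq GG' Wh) !G'E !wwtE !ifT; try by apply/eqP; rewrite /m; lia.
  rewrite -/(x _) f1 // /incr cab ifT ?subrr //; apply/eqP; rewrite /m; lia.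
- rewrite leq_eqVlt G'E => /andP[/orP[/eqP <-|]]; first by rewrite eqxx f2.
  by move=> mw wk; rewrite gtn_eqF // G3 // mw.
Qed.
End PBW.

(** * The deformed commutation relations of the pure virtual braid group *)

#[global] Instance ncring_ops (R : pzRingType) : @Ncring.Ring_ops R 0 1
  (@GRing.add R) (@GRing.mul R) (fun x y => x - y) (@GRing.opp R) (@eq R) := {}.

#[global] Instance ncring (R : pzRingType) : Ncring.Ring (Ro := ncring_ops R).
Proof.
split.
- exact: RelationClasses.eq_equivalence.
- by move=> x _ <- y _ <-.
- by move=> x _ <- y _ <-.
- by move=> x _ <- y _ <-.
- by move=> x _ <-.
- move=> x; exact: add0r.
- move=> x y; exact: addrC.
- move=> x y z; exact: addrA.
- move=> x; exact: mul1r.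
- move=> x; exact: mulr1.
- move=> x y z; exact: mulrA.
- move=> x y z; exact: mulrDl.
- move=> x y z; exact: mulrDr.
- by move=> x y.
- move=> x; exact: subrr.
Qed.

Ltac ncr := Ncring_tac.non_commutative_ring.

Definition br (B : pzRingType) (p q : B) : B := p * q - q * p.

(* [(false, (i, j))] is the letter r_ij and [(true, (i, j))] the letter
   r_ij + r_ji; the elements with [i >= j] are junk *)
Definition lett (n : nat) : finType := (bool * ('I_n * 'I_n))%type.

Section Letters.
Context (n : nat).
Implicit Types (a b c e : lett n).

Definition legit a := (a.2.1 < a.2.2)%N.

(* assumes that the second index of [a] is below that of [b]: then all pairs
   commute up to heavier terms, except r_jl with a letter of second index [j] *)
Definition lcomm a b := (b.2.1 == a.2.2) ==> b.1.

Definition comm a b :=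
  [&& legit a, legit b & if (a.2.2 < b.2.2)%N then lcomm a b
                         else (b.2.2 < a.2.2)%N && lcomm b a].

Definition disj a b := [&& a.2.1 != b.2.1, a.2.1 != b.2.2, a.2.2 != b.2.1 & a.2.2 != b.2.2].

Definition on (I : seq 'I_n) : pred (lett n) := fun e =>
  [&& legit e, e.2.1 \in I & e.2.2 \in I].

Definition supp a : seq 'I_n := [:: a.2.1; a.2.2].

Lemma comm_sym : symmetric comm.
Proof.
move=> a b; rewrite /comm andbCA; congr [&& _, _ & _].
by case: ltngtP.
Qed.

Lemma comm_irr : irreflexive comm.
Proof. by move=> a; rewrite /comm ltnn !andbF. Qed.
End Letters.

Section Relations.
Context (n : nat) (B : algType rat) (mon : seq (lett n) -> B).
Hypothesis mon0 : mon [::] = 1.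
Hypothesis monM : forall u v, mon (u ++ v) = mon u * mon v.
Context (M : nat).
Hypothesis ltM : (6 * n < M)%N.
Implicit Types (i j k l : 'I_n) (a b c e : lett n).

Definition wt a : nat := (M + a.2.1 + a.2.2)%N.

Local Notation x := (letx mon).
Local Notation W := (wspan mon wt).
Local Notation Wd := (wspand mon wt).

Definition rgen i j : B :=
  if (i < j)%N then x (false, (i, j)) else x (true, (j, i)) - x (false, (j, i)).

Local Notation r := rgen.

(** [rho] and [cub] are the parts of degree 2 and 3 of the Yang-Baxter relation in R = 1 + r; the
    lower parts cancel, see [ybeE]. *)
Definition rho i j k : B :=
  br (r i j) (r i k) + br (r i j) (r j k) + br (r i k) (r j k).

Definition cub i j k : B := r i j * r i k * r j k - r j k * r i k * r i j.

Definition ybe i j k : B := rho i j k + cub i j k.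

Lemma ybeE i j k : ybe i j k =
  (1 + r i j) * (1 + r i k) * (1 + r j k) - (1 + r j k) * (1 + r i k) * (1 + r i j).
Proof.
rewrite /ybe /rho /cub /br; move: (r i j) (r i k) (r j k) => p q s; ncr.
Qed.

(* The combination of the relations [Y] with lightest term [br (x a) (x b)];
   [Y] is [ybe] for the group and [rho] for the quadratic algebra. *)
Definition srel (Y : 'I_n -> 'I_n -> 'I_n -> B) a b : B :=
  let: (s, (i, j)) := a in let: (t, (k, l)) := b in
  if k == i then
    if t then (if s then Y j i l + Y j l i else 0) - (Y i l j + Y l i j)
    else Y i j l + (if s then Y j i l else 0)
  else if k == j then
    Y i j l + Y i l j - (if s then Y j l i + Y l j i else 0)
  else br (x a) (x b).

Definition relator Y a b : B :=
  if (a.2.2 < b.2.2)%N then srel Y a b else - srel Y b a.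

Local Notation sigma := relator.

Definition corr Y a b : B := br (x a) (x b) - sigma Y a b.
Local Notation h := corr.

Lemma h_anti Y a b : comm a b -> h Y b a = - h Y a b.
Proof.
case/and3P=> _ _; rewrite /h /sigma; case: ltngtP => // _ _; rewrite /br.
  by move: (srel Y a b) (x a) (x b) => p q s; ncr.
by move: (srel Y b a) (x a) (x b) => p q s; ncr.
Qed.

Lemma crelE Y a b : crel mon (h Y) a b = sigma Y a b.
Proof. by rewrite /crel /h /br; move: (sigma Y a b) (x a) (x b) => p q s; ncr. Qed.

Definition sgen i j : B := r i j + r j i.
Local Notation s := sgen.

Lemma x_r i j : (i < j)%N -> x (false, (i, j)) = r i j.
Proof. by rewrite /r => ->. Qed.

Lemma x_s i j : (i < j)%N -> x (true, (i, j)) = s i j.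
Proof.
move=> ij; rewrite /s /r ij ltnNge (ltnW ij) /=.
by move: (x (false, _)) (x _) => p q; ncr.
Qed.

Definition lead (t : bool) i j : B := if t then s i j else r i j.

Lemma x_lead t i j : (i < j)%N -> x (t, (i, j)) = lead t i j.
Proof. by case: t => /=; [apply: x_s|apply: x_r]. Qed.

(** The quadratic correction in closed form, as commutators of heavier elements; weights and indices
    can be read off from it. *)
Definition tail a b : B :=
  let: (t, (i, j)) := a in let: (u, (k, l)) := b in
  if k == i then
    if u then br (lead true i l) (lead t l j)
    else - br (lead t i j) (r j l) - (if t then 0 else br (r i l) (r j l))
  else if k == j then - br (lead t i l) (s j l)
  else 0.

Lemma h_tail a b : legit a -> legit b -> (a.2.2 < b.2.2)%N -> lcomm a b ->
  h rho a b = tail a b.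
Proof.
case: a b => [t [i j]] [u [k l]]; rewrite /legit /lcomm /= => ij kl jl.
rewrite /h /sigma jl /srel /tail.
have [->|nki] := eqVneq k i.
  move=> _; have il : (i < l)%N by lia.
  rewrite !x_lead // /lead /s /rho /br.
  move: (r i j) (r j i) (r i l) (r l i) (r j l) (r l j) => p1 p2 p3 p4 p5 p6.
  by case: t; case: u; ncr.
have [ekj|_] := eqVneq k j => [ut|_]; last by rewrite subrr.
subst k; have il : (i < l)%N by lia.
case: u ut => // _; rewrite !x_lead // /lead /s /rho /br.
move: (r i j) (r j i) (r i l) (r l i) (r j l) (r l j) => p1 p2 p3 p4 p5 p6.
by case: t; ncr.
Qed.

Lemma ord_neq i j : i <> j :> nat -> i != j.
Proof. by move=> ij; apply/eqP => e; apply: ij; rewrite e. Qed.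

(** * Weights and supports of the corrections *)

Section Weights.
Variable I : seq 'I_n.
Local Notation Wd := (Wd (on I)).
Local Notation W := (W (on I)).

Lemma Wd_x t i j : (i < j)%N -> i \in I -> j \in I -> Wd 1%N (M + i + j)%N (x (t, (i, j))).
Proof.
move=> ij iI jI; apply: span_mon.
by rewrite /homw /heavy /wwt /wt /= /on /legit /= ij iI jI; lia.
Qed.

Lemma Wd_r i j : i <> j :> nat -> i \in I -> j \in I -> Wd 1%N (M + i + j)%N (r i j).
Proof.
move=> ij iI jI; rewrite /r; case: ifP => [lij|nij]; first exact: Wd_x.
have lji : (j < i)%N by lia.
by rewrite addnAC; apply: spanB; apply: Wd_x.
Qed.

Lemma Wd_lead t i j : i <> j :> nat -> i \in I -> j \in I ->
  Wd 1%N (M + i + j)%N (lead t i j).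
Proof.
move=> ij iI jI; case: t => /=; last exact: Wd_r.
by apply: spanD; last (rewrite addnAC; move/nesym in ij); apply: Wd_r.
Qed.

Lemma Wd_br (d e m q : nat) u v :
  Wd d m u -> Wd e q v -> Wd (d + e)%N (m + q)%N (br u v).
Proof.
move=> Wu Wv; apply: spanB; first exact: WdM.
by rewrite (addnC d) (addnC m); apply: WdM.
Qed.

Lemma W_r i j : i <> j :> nat -> i \in I -> j \in I -> W M (r i j).
Proof. by move=> ij iI jI; apply: W_weak (Wd_W (Wd_r ij iI jI)); lia. Qed.

Lemma W_cub i j k : i <> j :> nat -> i <> k :> nat -> j <> k :> nat ->
  i \in I -> j \in I -> k \in I -> W (M + M + M)%N (ybe i j k - rho i j k).
Proof.
move=> ij ik jk iI jI kI; rewrite /ybe addrC addKr.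
by apply: spanB; (apply: WM => //; first apply: WM => //); apply: W_r.
Qed.
End Weights.

Definition isupp a b := supp a ++ supp b.

Lemma tail_Wd a b : legit a -> legit b -> (a.2.2 < b.2.2)%N -> lcomm a b ->
  Wd (on (isupp a b)) 2%N (wt a + wt b).+1%N (tail a b).
Proof.
case: a b => [t [i j]] [u [k l]]; rewrite /legit /lcomm /tail /wt /isupp /supp /=.
move=> ij kl jl; have [->|nki] := eqVneq k i => [_|].
  have il : (i < l)%N by lia.
  case: u.
    apply: Wd_weak (Wd_br (@Wd_lead _ true i l _ _ _) (@Wd_lead _ t l j _ _ _));
      rewrite ?inE ?eqxx ?orbT //; lia.
  apply: spanB; first apply: spanN.
    apply: Wd_weak (Wd_br (@Wd_lead _ t i j _ _ _) (@Wd_r _ j l _ _ _));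
      rewrite ?inE ?eqxx ?orbT //; lia.
  case: t; first exact: span0.
  apply: Wd_weak (Wd_br (@Wd_r _ i l _ _ _) (@Wd_r _ j l _ _ _));
      rewrite ?inE ?eqxx ?orbT //; lia.
have [ekj _|_ _] := eqVneq k j; last exact: span0.
subst k; apply: spanN.
apply: Wd_weak (Wd_br (@Wd_lead _ t i l _ _ _) (@Wd_lead _ true j l _ _ _));
  rewrite ?inE ?eqxx ?orbT //; lia.
Qed.

Lemma srel_cub a b : legit a -> legit b -> (a.2.2 < b.2.2)%N ->
  W (on (isupp a b)) (M + M + M)%N (srel ybe a b - srel rho a b).
Proof.
move: (M + M + M)%N (@W_cub) => k0 W_cub.
have cD D p q p' q' : W D k0 (p - q) -> W D k0 (p' - q') -> W D k0 (p + p' - (q + q')).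
  by move=> h1 h2; rewrite opprD addrACA; apply: spanD.
have cN D p q : W D k0 (p - q) -> W D k0 (- p - - q).
  by move=> h1; rewrite -opprD; apply: spanN.
have c0 D p : W D k0 (p - p) by rewrite subrr; apply: span0.
case: a b => [t [i j]] [u [k l]].
rewrite /legit /lcomm /srel /isupp /supp /= => ij kl jl.
have [eki|nki] := eqVneq k i.
  subst k; case: u; case: t; do ?[apply: (W_cub) | apply: (c0) | apply: (cD) | apply: (cN)];
    rewrite ?inE ?eqxx ?orbT //; lia.
have [ekj|_] := eqVneq k j; last exact: c0.
subst k; case: t; do ?[apply: (W_cub) | apply: (c0) | apply: (cD) | apply: (cN)];
    rewrite ?inE ?eqxx ?orbT //; lia.
Qed.

Lemma h_W a b : comm a b -> W (on (isupp a b)) (wt a + wt b).+1%N (h ybe a b).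
Proof.
wlog lab : a b / (a.2.2 < b.2.2)%N => [IH|].
  move=> cab; have [|lba|e] := ltngtP a.2.2 b.2.2; first by move/IH; apply.
    have cba : comm b a by rewrite comm_sym.
    rewrite (h_anti _ cba) (addnC (wt a)); apply: spanN.
    apply: W_sub (IH b a lba cba).
      move=> e /and3P[le h1 h2]; rewrite /on le /=; move: h1 h2.
      rewrite /isupp /supp !mem_cat => h1 h2.
      by rewrite orbC h1 orbC h2.
  by case/and3P: cab; rewrite e ltnn.
case/and3P=> la lb; rewrite lab => lcab.
have -> : h ybe a b = h rho a b - (srel ybe a b - srel rho a b).
  rewrite /h /sigma lab; move: (srel ybe a b) (srel rho a b) (br _ _) => p q u; ncr.
rewrite h_tail //; apply: spanB; first exact: Wd_W (tail_Wd la lb lab lcab).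
(* A cubic term weighs at least 3M, which exceeds 2M plus any four indices. *)
apply: W_weak (srel_cub la lb lab); rewrite /wt.
have := ltn_ord a.2.1; have := ltn_ord a.2.2; have := ltn_ord b.2.1.
have := ltn_ord b.2.2; lia.
Qed.

Lemma rel_low Y t u i j l : (j < l)%N -> sigma Y (t, (i, j)) (u, (i, l)) =
  if u then (if t then Y j i l + Y j l i else 0) - (Y i l j + Y l i j)
  else Y i j l + (if t then Y j i l else 0).
Proof. by move=> jl; rewrite /sigma /= jl eqxx. Qed.

Lemma rel_chain Y t i j l : (i < j < l)%N -> sigma Y (t, (i, j)) (true, (j, l)) =
  Y i j l + Y i l j - (if t then Y j l i + Y l j i else 0).
Proof. by case/andP=> ij jl; rewrite /sigma /= jl eqxx -val_eqE gtn_eqF. Qed.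

Lemma comm_low t u i j l : (i < j)%N -> (j < l)%N -> comm (t, (i, j)) (u, (i, l)).
Proof.
move=> ij jl; rewrite /comm /legit /lcomm /= jl ij (ltn_trans ij jl) /=.
by rewrite -val_eqE ltn_eqF.
Qed.

Lemma comm_chain t i j l : (i < j)%N -> (j < l)%N -> comm (t, (i, j)) (true, (j, l)).
Proof. by move=> ij jl; rewrite /comm /legit /lcomm /= ij jl implybT. Qed.

Lemma comm_disj a b : legit a -> legit b -> disj a b -> comm a b.
Proof.
case: a b => [t [i j]] [u [k l]]; rewrite /comm /legit /lcomm /= => -> ->.
case/and4P=> /= _ il jk; rewrite (eq_sym k) (negPf jk) (negPf il) /=.
by rewrite -val_eqE /=; case: ltngtP.
Qed.

Lemma rel_disj Y a b : disj a b -> sigma Y a b = br (x a) (x b).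
Proof.
case: a b => [t [i j]] [u [k l]]; case/and4P=> /= /negPf ik /negPf il /negPf jk _.
rewrite /sigma /srel /= !(eq_sym k) ik jk il.
case: ifP => _ //.
by rewrite /br; move: (x _) (x (t, _)) => p q; ncr.
Qed.

(** * Yang-Baxter relations and commutators under a functional that kills the relators *)

Section Kill.
Variables (K : nat) (G : {linear B -> rat^o}).
Hypothesis GK : kills mon wt (@comm n) (h ybe) K G.
Local Notation V := (W predT).

(** [w] is the weight credited to [Q]; a larger [w] is a stronger claim. *)
Definition killed w Q := forall p q m m', V m p -> V m' q ->
  (K <= m + w + m')%N -> G (p * Q * q) = 0.

Lemma killedD w p q : killed w p -> killed w q -> killed w (p + q).
Proof.
by move=> kp kq u v m m' Wu Wv le; rewrite mulrDr mulrDl linearD /= (kp _ _ _ _ Wu Wv)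
  ?(kq _ _ _ _ Wu Wv) ?addr0.
Qed.

Lemma killedN w p : killed w p -> killed w (- p).
Proof.
by move=> kp u v m m' Wu Wv le; rewrite mulrN mulNr linearN /= (kp _ _ _ _ Wu Wv) ?oppr0.
Qed.

Lemma killedB w p q : killed w p -> killed w q -> killed w (p - q).
Proof. by move=> kp kq; apply: killedD => //; apply: killedN. Qed.

Lemma killed_weak w w' p : (w' <= w)%N -> killed w p -> killed w' p.
Proof. by move=> le kp u v m m' Wu Wv le'; apply: kp Wu Wv _; lia. Qed.

Lemma killed_rel a b : comm a b -> killed (wt a + wt b) (sigma ybe a b).
Proof.
by move=> cab p q m m' Wp Wq le; rewrite -crelE; apply: killsE GK cab Wp Wq le.
Qed.

(** In this sum, as in the one of [killed_source], the lightest commutators cancel: the middle index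
    is counted twice, where a single relation counts the least index twice. This gain separates the
    terms that survive in the hexagons. *)
Lemma killed_target i j k : (i < j)%N -> (j < k)%N ->
  killed (M + M + i + j + j + k) (ybe i j k + ybe i k j).
Proof.
move=> ij jk; have := killed_rel (comm_chain false ij jk).
by rewrite rel_chain ?ij // subr0; apply: killed_weak; rewrite /wt /=; lia.
Qed.

Lemma killed_source i j k : (i < j)%N -> (j < k)%N ->
  killed (M + M + i + j + j + k) (ybe j k i + ybe k j i).
Proof.
move=> ij jk; have := killed_rel (comm_chain true ij jk); rewrite rel_chain ?ij //.
move/(killedB (killed_rel (comm_chain false ij jk))); rewrite rel_chain ?ij // subr0.
by rewrite opprB addrC subrK; apply: killed_weak; rewrite /wt /=; lia.
Qed.

(** The six relators on a triple, four with common least index and two chains, are solved for the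
    six Yang-Baxter relations. *)
Lemma killed_ybe i j k : i <> j :> nat -> i <> k :> nat -> j <> k :> nat ->
  killed (M + M + i + j + k + minn i (minn j k)) (ybe i j k).
Proof.
suff H (a b c : 'I_n) : (a < b)%N -> (b < c)%N -> let w := (M + M + a + a + b + c)%N in
  [/\ killed w (ybe a b c), killed w (ybe b a c), killed w (ybe a c b),
      killed w (ybe c a b) & killed w (ybe b c a) /\ killed w (ybe c b a)].
  move=> ij ik jk.
  have [lij|lij] : (i < j)%N \/ (j < i)%N by lia.
    have [ljk|lkj] : (j < k)%N \/ (k < j)%N by lia.
      by case: (H _ _ _ lij ljk) => + *; apply: killed_weak; lia.
    have [lik|lki] : (i < k)%N \/ (k < i)%N by lia.
      by case: (H _ _ _ lik lkj) => _ _ + *; apply: killed_weak; lia.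
    by case: (H _ _ _ lki lij) => _ _ _ _ [+ _]; apply: killed_weak; lia.
  have [lik|lki] : (i < k)%N \/ (k < i)%N by lia.
    by case: (H _ _ _ lij lik) => _ + *; apply: killed_weak; lia.
  have [ljk|lkj] : (j < k)%N \/ (k < j)%N by lia.
    by case: (H _ _ _ ljk lki) => _ _ _ + *; apply: killed_weak; lia.
  by case: (H _ _ _ lkj lij) => _ _ _ _ [_]; apply: killed_weak; lia.
move=> ab bc w.
have low t u : killed w (sigma ybe (t, (a, b)) (u, (a, c))).
  by apply: killed_weak (killed_rel (comm_low t u ab bc)); rewrite /wt /=; lia.
have kt := killed_weak (w' := w) _ (killed_target ab bc).
have ks := killed_weak (w' := w) _ (killed_source ab bc).
have {}kt : killed w (ybe a b c + ybe a c b) by apply: kt; lia.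
have {}ks : killed w (ybe b c a + ybe c b a) by apply: ks; lia.
have e1 := low false false; have e2 := low true false; have e3 := low false true.
have e4 := low true true; rewrite !rel_low //= in e1 e2 e3 e4.
have k1 : killed w (ybe a b c) by rewrite addr0 in e1.
have k2 : killed w (ybe b a c) by have := killedB e2 k1; rewrite addrAC subrr add0r.
have k3 : killed w (ybe a c b) by have := killedB kt k1; rewrite addrAC subrr add0r.
have k4 : killed w (ybe c a b).
  by have := killedB (killedN e3) k3; rewrite sub0r opprK addrAC subrr add0r.
have k5 : killed w (ybe b c a).
  have := killedB (killedB e4 e3) k2; rewrite sub0r opprK subrK.
  by rewrite addrAC subrr add0r.
by split=> //; split=> //; have := killedB ks k5; rewrite addrAC subrr add0r.
Qed.

Lemma killed_comm i j k l : uniq [:: i; j; k; l] ->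
  killed (M + M + i + j + k + l) (br (r i j) (r k l)).
Proof.
move=> U; pose w := (M + M + i + j + k + l)%N.
have kx t u (a b c e : 'I_n) : perm_eq [:: i; j; k; l] [:: a; b; c; e] -> (a < b)%N -> (c < e)%N ->
    killed w (br (x (t, (a, b))) (x (u, (c, e)))).
  move=> pe ab ce; have U' : uniq [:: a; b; c; e] by rewrite -(perm_uniq pe).
  have d : disj (t, (a, b)) (u, (c, e)).
    move: U'; rewrite /disj /= !inE !negb_or.
    by case/and4P=> /and3P[_ -> ->] /andP[-> ->].
  rewrite -(rel_disj ybe d); apply: killed_weak (killed_rel (comm_disj _ _ d)) => //.
  have : sumn (map val [:: i; j; k; l]) = sumn (map val [:: a; b; c; e]).
    by apply/perm_sumn/perm_map.
  by rewrite /wt /w /=; lia.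
have kB (a b c : B) : killed w (br a c) -> killed w (br b c) -> killed w (br (a - b) c).
  move=> ka kb; have -> : br (a - b) c = br a c - br b c by rewrite /br; ncr.
  exact: killedB.
have kC (a b c : B) : killed w (br a b) -> killed w (br a c) -> killed w (br a (b - c)).
  move=> ka kb; have -> : br a (b - c) = br a b - br a c by rewrite /br; ncr.
  exact: killedB.
have [ij kl] : i <> j :> nat /\ k <> l :> nat.
  by split=> e; move: U; rewrite (ord_inj e) /= !inE eqxx ?orbT ?andbF.
by rewrite /r; do 2!case: ifP => ?; do ?[apply: (kB) | apply: (kC)]; apply: kx;
  rewrite /legit /=; try (by apply/permP => P /=; lia); lia.
Qed.

Lemma V1 : V 0 1.
Proof. by rewrite -mon0; apply: W_mon; rewrite ?all_predT. Qed.

Definition bcomm (Q z : B) : rat := G (br Q z).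

Lemma killed_bcomm w m Q z : killed w Q -> V m z -> (K <= w + m)%N -> bcomm Q z = 0.
Proof.
move=> kQ Vz le; rewrite /bcomm /br linearB /=.
rewrite -[Q * z]mul1r mulrA (kQ _ _ _ _ V1 Vz) ?add0n //.
by rewrite -[z * Q]mulr1 (kQ _ _ _ _ Vz V1) ?subrr //; lia.
Qed.

(** * The tetrahedron identity and the hexagons *)

Section Zamolodchikov.
Hypothesis leK : (K <= 4 * M)%N.

Lemma prod1D_V (us : seq B) : (forall u, u \in us -> V M u) ->
  [/\ V 0 (\prod_(u <- us) (1 + u)), V M (\sum_(u <- us) u) &
     V (M + M)%N (\prod_(u <- us) (1 + u) - 1 - \sum_(u <- us) u)].
Proof.
elim: us => [|u us IH] Vus.
  by rewrite !big_nil subrr subr0; split; [exact: V1|exact: span0|exact: span0].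
have Vu : V M u by apply: Vus; rewrite mem_head.
have [|h1 h2 h3] := IH; first by move=> v vus; apply: Vus; rewrite inE vus orbT.
rewrite !big_cons; move: h1 h2 h3.
set P := \prod_(_ <- _) _; set S := \sum_(_ <- _) _ => h1 h2 h3.
have Vu0 : V 0 (1 + u) by apply: spanD; [exact: V1|exact: W_weak Vu].
split; first by have := WM monM Vu0 h1.
  exact: spanD.
have -> : (1 + u) * P - 1 - (u + S) = (P - 1 - S) + u * S + u * (P - 1 - S).
  move: u P S {Vus Vu Vu0 h1 h2 h3} => u P S; ncr.
by apply: spanD; first apply: spanD; rewrite //; [apply: WM|apply: W_weak (WM monM Vu h3); lia].
Qed.

(** A relation is credited with 2M, so together with two further factors it reaches 4M, which is at
    least [K]; only the terms with at most one further factor survive. *)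
Lemma G_prod Q us vs : killed (M + M) Q ->
  (forall u, u \in us -> V M u) -> (forall v, v \in vs -> V M v) ->
  G (\prod_(u <- us) (1 + u) * Q * \prod_(v <- vs) (1 + v)) =
  G Q + G ((\sum_(u <- us) u) * Q) + G (Q * \sum_(v <- vs) v).
Proof.
move=> kQ /prod1D_V[u1 u2 u3] /prod1D_V[v1 v2 v3]; move: u1 u2 u3 v1 v2 v3.
move: (\prod_(u <- us) _) (\sum_(u <- us) _) => P S.
move: (\prod_(v <- vs) _) (\sum_(v <- vs) _) => P' S' u1 u2 u3 v1 v2 v3.
have -> : P * Q * P' = Q + S * Q + Q * S' + (P - 1 - S) * Q * P' + S * Q * S'
    + 1 * Q * (P' - 1 - S') + S * Q * (P' - 1 - S').
  by move: P S P' S' {u1 u2 u3 v1 v2 v3} Q kQ => P S P' S' Q _; ncr.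
rewrite !linearD /= (kQ _ _ _ _ u3 v1) ?(kQ _ _ _ _ u2 v2) ?(kQ _ _ _ _ V1 v3)
  ?(kQ _ _ _ _ u2 v3) ?addr0 //; lia.
Qed.

(** Both reversals of the word use the same four Yang-Baxter relations and three commutations, each
    once but in different surroundings. In the difference the bare relations cancel, and the linear
    parts of the surroundings combine into commutators. *)
Lemma zamolodchikov i j k l : i <> j :> nat /\ i <> k :> nat /\ i <> l :> nat /\
    j <> k :> nat /\ j <> l :> nat /\ k <> l :> nat ->
  bcomm (ybe i j k) (r i l + r j l + r k l)
  + bcomm (ybe i j l) (r k l - r i k - r j k)
  + bcomm (ybe i k l) (r i j - r j k - r j l)
  + bcomm (ybe j k l) (r i j + r i k + r i l)
  + bcomm (br (r i l) (r j k)) (r j l + r k l - r i j - r i k)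
  + bcomm (br (r i k) (r j l)) (r i j + r i l + r k l - r j k)
  - bcomm (br (r i j) (r k l)) (r i k + r i l + r j k + r j l) = 0.
Proof.
case=> ij [ik [il [jk [jl kl]]]]; have U : uniq [:: i; j; k; l].
  by rewrite -(map_inj_uniq val_inj) /= !inE !negb_or; lia.
have kY (a b c : 'I_n) : a <> b :> nat -> a <> c :> nat -> b <> c :> nat ->
    killed (M + M) (ybe a b c).
  by move=> ab ac bc; apply: killed_weak (killed_ybe ab ac bc); lia.
have kK (a b c d : 'I_n) : perm_eq [:: i; j; k; l] [:: a; b; c; d] ->
    killed (M + M) (br (r a b) (r c d)).
  move=> pe; have U2 : uniq [:: a; b; c; d] by rewrite -(perm_uniq pe).
  by apply: killed_weak (killed_comm U2); lia.
have Vr (a b : 'I_n) : a <> b :> nat -> V M (r a b).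
  by move=> ab; apply: W_sub (W_r (I := [:: a; b]) ab _ _); rewrite ?inE ?eqxx ?orbT.
pose T us Q vs := \prod_(u <- us) (1 + u) * Q * \prod_(v <- vs) (1 + v) : B.
have GT us Q vs : killed (M + M) Q ->
    all (fun u => u \in [:: r i j; r i k; r i l; r j k; r j l; r k l]) (us ++ vs) ->
    G (T us Q vs) = G Q + G ((\sum_(u <- us) u) * Q) + G (Q * \sum_(v <- vs) v).
  move=> kQ /allP h; have hV u : u \in us ++ vs -> V M u.
    by move/h; rewrite !inE; do 5!(case/orP=> [/eqP->|]; first exact: Vr); move/eqP->; exact: Vr.
  by apply: G_prod => // u uu; apply: hV; rewrite mem_cat uu ?orbT.
(* the two ways of reversing the word [ij ik il jk jl kl] *)
have tele :
  T [:: r i j; r i k] (br (r i l) (r j k)) [:: r j l; r k l]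
  + T [::] (ybe i j k) [:: r i l; r j l; r k l]
  + T [:: r j k; r i k] (ybe i j l) [:: r k l]
  + T [:: r j k] (br (r i k) (r j l)) [:: r i l; r i j; r k l]
  + T [:: r j k; r j l; r i k; r i l] (br (r i j) (r k l)) [::]
  + T [:: r j k; r j l] (ybe i k l) [:: r i j]
  + T [::] (ybe j k l) [:: r i l; r i k; r i j]
  - (T [:: r i j; r i k; r i l] (ybe j k l) [::]
  + T [:: r i j] (ybe i k l) [:: r j l; r j k]
  + T [::] (br (r i j) (r k l)) [:: r i l; r i k; r j l; r j k]
  + T [:: r k l; r i j; r i l] (br (r i k) (r j l)) [:: r j k]
  + T [:: r k l] (ybe i j l) [:: r i k; r j k]
  + T [:: r k l; r j l; r i l] (ybe i j k) [::]
  + T [:: r k l; r j l] (br (r i l) (r j k)) [:: r i k; r i j]) = 0.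
  rewrite /T !big_cons !big_nil !mulr1 !mul1r !ybeE /br.
  move: (r i j) (r i k) (r i l) (r j k) (r j l) (r k l) => p1 p2 p3 p4 p5 p6; ncr.
have := congr1 G tele; rewrite linearB !linearD linear0 /= !GT; last first.
all: try by rewrite /= !inE !eqxx ?orbT.
all: try by [apply: kY | apply: kK; apply/permP => P /=; lia].
rewrite /bcomm !big_cons !big_nil !addr0 !mulr0 !mul0r !linear0.
move: (ybe i j k) (ybe i j l) (ybe i k l) (ybe j k l) (br (r i l) (r j k))
  (br (r i k) (r j l)) (br (r i j) (r k l)) => y1 y2 y3 y4 k1 k2 k3.
move: (r i j) (r i k) (r i l) (r j k) (r j l) (r k l) => p1 p2 p3 p4 p5 p6.
have GD u v : G (u + v) = G u + G v by exact: linearD.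
have GN u : G (- u) = - G u by exact: linearN.
rewrite /br !(mulrDl, mulrDr, mulNr, mulrN, opprD, opprK).
rewrite !GD !GN => e; lra.
Qed.
End Zamolodchikov.

Lemma bcommDl p q z : bcomm (p + q) z = bcomm p z + bcomm q z.
Proof.
rewrite /bcomm; have -> : br (p + q) z = br p z + br q z by rewrite /br; ncr.
exact: linearD.
Qed.

Lemma bcommNl p z : bcomm (- p) z = - bcomm p z.
Proof.
rewrite /bcomm; have -> : br (- p) z = - br p z by rewrite /br; ncr.
exact: linearN.
Qed.

Lemma bcommDr p z y : bcomm p (z + y) = bcomm p z + bcomm p y.
Proof.
rewrite /bcomm; have -> : br p (z + y) = br p z + br p y by rewrite /br; ncr.
exact: linearD.
Qed.

Lemma bcommNr p z : bcomm p (- z) = - bcomm p z.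
Proof.
rewrite /bcomm; have -> : br p (- z) = - br p z by rewrite /br; ncr.
exact: linearN.
Qed.

Lemma bcomm_brC p q z : bcomm (br p q) z = - bcomm (br q p) z.
Proof. by rewrite -bcommNl; congr bcomm; rewrite /br opprB. Qed.

Lemma bcomm0l z : bcomm 0 z = 0.
Proof. by rewrite /bcomm /br mul0r mulr0 subr0 linear0. Qed.

Lemma brDl p q z : br (p + q) z = br p z + br q z :> B.
Proof. by rewrite /br; ncr. Qed.

Lemma brDr p q z : br z (p + q) = br z p + br z q :> B.
Proof. by rewrite /br; ncr. Qed.

Lemma V_r i j : i <> j :> nat -> V (M + i + j) (r i j).
Proof.
move=> ij; apply: (@W_sub _ _ _ _ (on [:: i; j])) => //.
by apply: Wd_W (Wd_r ij _ _); rewrite ?inE ?eqxx ?orbT.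
Qed.

Lemma bcomm_ybe0 i j k (p q : 'I_n) :
  i <> j :> nat /\ i <> k :> nat /\ j <> k :> nat /\ p <> q :> nat /\
  (K <= 3 * M + i + j + k + minn i (minn j k) + p + q)%N ->
  bcomm (ybe i j k) (r p q) = 0.
Proof.
case=> ij [ik [jk [pq le]]]; apply: (killed_bcomm (killed_ybe ij ik jk) (V_r pq)).
lia.
Qed.

(** When neither term vanishes by weight alone, the extra weight of their sum still makes them
    opposite. Trading towards increasing last two indices leaves one representative. *)
Lemma bcomm_target i j k (p q : 'I_n) : (i < k)%N /\ (k < j)%N /\ p <> q :> nat /\
  (K <= 3 * M + i + k + k + j + p + q)%N ->
  bcomm (ybe i j k) (r p q) = - bcomm (ybe i k j) (r p q).
Proof.
case=> ik [kj [pq le]]; apply/eqP; rewrite -addr_eq0 -bcommDl addrC; apply/eqP.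
apply: (killed_bcomm (killed_target ik kj) (V_r pq)).
lia.
Qed.

Lemma bcomm_source i j k (p q : 'I_n) : (k < j)%N /\ (j < i)%N /\ p <> q :> nat /\
  (K <= 3 * M + k + j + j + i + p + q)%N ->
  bcomm (ybe i j k) (r p q) = - bcomm (ybe j i k) (r p q).
Proof.
case=> kj [ji [pq le]]; apply/eqP; rewrite -addr_eq0 -bcommDl addrC; apply/eqP.
apply: (killed_bcomm (killed_source kj ji) (V_r pq)).
lia.
Qed.

Lemma bcomm_comm0 i j k l (p q : 'I_n) : uniq [:: val i; val j; val k; val l] /\ p <> q :> nat /\
  (K <= 3 * M + i + j + k + l + p + q)%N ->
  bcomm (br (r i j) (r k l)) (r p q) = 0.
Proof.
case=> U [pq le]; have U' : uniq [:: i; j; k; l] by rewrite -(map_inj_uniq val_inj).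
apply: (killed_bcomm (killed_comm U') (V_r pq)).
lia.
Qed.

Definition bkeep := bcomm.

(* The terms whose weight forces them to vanish are discarded; [bkeep] marks the
   others, so that each is treated once. *)
Ltac bnorm ij jk kl eK l :=
  let solve_side := clear - ij jk kl eK; lia in
  repeat match goal with
  | |- context [bcomm (ybe ?i ?j ?k) (r ?p ?q)] => first
    [ rewrite (@bcomm_ybe0 i j k p q); [|solve_side]
    | rewrite (@bcomm_target i j k p q); [|solve_side]
    | rewrite (@bcomm_source i j k p q); [|solve_side]
    | rewrite -[bcomm (ybe i j k) (r p q)]/(bkeep (ybe i j k) (r p q)) ]
  | |- context [bcomm (br (r l ?j) ?y) ?z] => rewrite (bcomm_brC (r l j) y z)
  | |- context [bcomm (br (r ?i l) ?y) ?z] => rewrite (bcomm_brC (r i l) y z)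
  | |- context [bcomm (br (r ?i ?j) (r ?k ?m)) (r ?p ?q)] => first
    [ rewrite (@bcomm_comm0 i j k m p q); [|rewrite /= !inE !negb_or; solve_side]
    | rewrite -[bcomm (br (r i j) (r k m)) (r p q)]
        /(bkeep (br (r i j) (r k m)) (r p q)) ]
  end.

Ltac bexpand := repeat match goal with
  | |- context [br (?p + ?q) ?z] => rewrite (brDl p q z)
  | |- context [br ?z (?p + ?q)] => rewrite (brDr p q z)
  | |- context [bcomm (?p + ?q) ?z] => rewrite (bcommDl p q z)
  | |- context [bcomm (- ?p) ?z] => rewrite (bcommNl p z)
  | |- context [bcomm 0 ?z] => rewrite (bcomm0l z)
  | |- context [bcomm ?p (?z + ?y)] => rewrite (bcommDr p z y)
  | |- context [bcomm ?p (- ?z)] => rewrite (bcommNr p z)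
  end.

Lemma jacobi_bcomm a b c : (a.2.2 < c.2.2)%N -> G (jacobiator mon (h ybe) a b c) =
  bcomm (sigma ybe a b) (x c) + bcomm (sigma ybe b c) (x a)
  - bcomm (sigma ybe a c) (x b).
Proof.
move=> ac; rewrite /jacobiator !crelE.
have -> : sigma ybe c a = - sigma ybe a c by rewrite /sigma ac ltnNge (ltnW ac).
by rewrite -bcommNl /bcomm /br !linearD.
Qed.

(** First of six hexagons, one for each tree on i < j < k < l in which every vertex except i is
    joined to exactly one smaller vertex; in the names, the digits 1 to 4 stand for these indices.
    [K] is one more than the weight of the triple, so only the lightest terms survive. As it is 3M
    plus six indices plus 1, the bound 6n < M gives [leK]. *)
Lemma lift_star i j k l t u v : (i < j)%N -> (j < k)%N -> (k < l)%N ->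
  K = (3 * M + i + i + i + j + k + l).+1 ->
  G (jacobiator mon (h ybe) (t, (i, j)) (u, (i, k)) (v, (i, l))) = 0.
Proof.
move=> ij jk kl eK; have leK : (K <= 4 * M)%N.
  have := ltn_ord i; have := ltn_ord j; have := ltn_ord k; have := ltn_ord l; lia.
(* Eight orderings of the four indices. Once the heavy terms are dropped they are linear equations
   between the surviving values of [bcomm], and they imply the hexagon for every choice of [t], [u],
   [v]. *)
have := zamolodchikov leK (i := i) (j := j) (k := k) (l := l) ltac:(lia).
have := zamolodchikov leK (i := j) (j := i) (k := k) (l := l) ltac:(lia).
have := zamolodchikov leK (i := j) (j := k) (k := i) (l := l) ltac:(lia).
have := zamolodchikov leK (i := j) (j := k) (k := l) (l := i) ltac:(lia).
have := zamolodchikov leK (i := j) (j := l) (k := i) (l := k) ltac:(lia).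
have := zamolodchikov leK (i := k) (j := i) (k := j) (l := l) ltac:(lia).
have := zamolodchikov leK (i := k) (j := l) (k := i) (l := j) ltac:(lia).
have := zamolodchikov leK (i := l) (j := i) (k := j) (l := k) ltac:(lia).
bexpand; bnorm ij jk kl eK l.
move=> z1 z2 z3 z4 z5 z6 z7 z8; rewrite jacobi_bcomm /=; last lia.
rewrite !rel_low; try lia.
rewrite !x_lead; try lia.
case: v; case: u; case: t; rewrite /lead /s; bexpand;
  bnorm ij jk kl eK l; lra.
Qed.

Lemma lift_12_13_24 i j k l t u : (i < j)%N -> (j < k)%N -> (k < l)%N ->
  K = (3 * M + i + i + j + j + k + l).+1 ->
  G (jacobiator mon (h ybe) (t, (i, j)) (u, (i, k)) (true, (j, l))) = 0.
Proof.
move=> ij jk kl eK; have leK : (K <= 4 * M)%N.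
  have := ltn_ord i; have := ltn_ord j; have := ltn_ord k; have := ltn_ord l; lia.
have := zamolodchikov leK (i := i) (j := k) (k := j) (l := l) ltac:(lia).
have := zamolodchikov leK (i := i) (j := k) (k := l) (l := j) ltac:(lia).
have := zamolodchikov leK (i := j) (j := l) (k := i) (l := k) ltac:(lia).
have := zamolodchikov leK (i := k) (j := i) (k := j) (l := l) ltac:(lia).
have := zamolodchikov leK (i := k) (j := i) (k := l) (l := j) ltac:(lia).
have := zamolodchikov leK (i := k) (j := j) (k := l) (l := i) ltac:(lia).
have := zamolodchikov leK (i := k) (j := l) (k := j) (l := i) ltac:(lia).
have := zamolodchikov leK (i := l) (j := j) (k := i) (l := k) ltac:(lia).
bexpand; bnorm ij jk kl eK l.
move=> z1 z2 z3 z4 z5 z6 z7 z8; rewrite jacobi_bcomm /=; last lia.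
rewrite (rel_disj _ _ (a := (u, (i, k))) (b := (true, (j, l))));
  last by rewrite /disj /= -!val_eqE /=; lia.
rewrite !rel_low; try lia.
rewrite !rel_chain; try lia.
rewrite !x_lead; try lia.
case: u; case: t; rewrite /lead /s; bexpand;
  bnorm ij jk kl eK l; lra.
Qed.

Lemma lift_12_13_34 i j k l t u : (i < j)%N -> (j < k)%N -> (k < l)%N ->
  K = (3 * M + i + i + j + k + k + l).+1 ->
  G (jacobiator mon (h ybe) (t, (i, j)) (u, (i, k)) (true, (k, l))) = 0.
Proof.
move=> ij jk kl eK; have leK : (K <= 4 * M)%N.
  have := ltn_ord i; have := ltn_ord j; have := ltn_ord k; have := ltn_ord l; lia.
have := zamolodchikov leK (i := i) (j := j) (k := k) (l := l) ltac:(lia).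
have := zamolodchikov leK (i := i) (j := j) (k := l) (l := k) ltac:(lia).
have := zamolodchikov leK (i := j) (j := i) (k := k) (l := l) ltac:(lia).
have := zamolodchikov leK (i := j) (j := i) (k := l) (l := k) ltac:(lia).
have := zamolodchikov leK (i := j) (j := k) (k := l) (l := i) ltac:(lia).
have := zamolodchikov leK (i := j) (j := l) (k := k) (l := i) ltac:(lia).
have := zamolodchikov leK (i := k) (j := l) (k := i) (l := j) ltac:(lia).
have := zamolodchikov leK (i := l) (j := k) (k := i) (l := j) ltac:(lia).
bexpand; bnorm ij jk kl eK l.
move=> z1 z2 z3 z4 z5 z6 z7 z8; rewrite jacobi_bcomm /=; last lia.
rewrite (rel_disj _ _ (a := (t, (i, j))) (b := (true, (k, l))));
  last by rewrite /disj /= -!val_eqE /=; lia.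
rewrite !rel_low; try lia.
rewrite !rel_chain; try lia.
rewrite !x_lead; try lia.
case: u; case: t; rewrite /lead /s; bexpand;
  bnorm ij jk kl eK l; lra.
Qed.

Lemma lift_12_23_14 i j k l t v : (i < j)%N -> (j < k)%N -> (k < l)%N ->
  K = (3 * M + i + i + j + j + k + l).+1 ->
  G (jacobiator mon (h ybe) (t, (i, j)) (true, (j, k)) (v, (i, l))) = 0.
Proof.
move=> ij jk kl eK; have leK : (K <= 4 * M)%N.
  have := ltn_ord i; have := ltn_ord j; have := ltn_ord k; have := ltn_ord l; lia.
have := zamolodchikov leK (i := i) (j := j) (k := k) (l := l) ltac:(lia).
have := zamolodchikov leK (i := i) (j := k) (k := j) (l := l) ltac:(lia).
have := zamolodchikov leK (i := j) (j := k) (k := i) (l := l) ltac:(lia).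
have := zamolodchikov leK (i := j) (j := k) (k := l) (l := i) ltac:(lia).
have := zamolodchikov leK (i := k) (j := j) (k := i) (l := l) ltac:(lia).
have := zamolodchikov leK (i := k) (j := j) (k := l) (l := i) ltac:(lia).
have := zamolodchikov leK (i := l) (j := i) (k := j) (l := k) ltac:(lia).
have := zamolodchikov leK (i := l) (j := i) (k := k) (l := j) ltac:(lia).
bexpand; bnorm ij jk kl eK l.
move=> z1 z2 z3 z4 z5 z6 z7 z8; rewrite jacobi_bcomm /=; last lia.
rewrite (rel_disj _ _ (a := (true, (j, k))) (b := (v, (i, l))));
  last by rewrite /disj /= -!val_eqE /=; lia.
rewrite !rel_low; try lia.
rewrite !rel_chain; try lia.
rewrite !x_lead; try lia.
case: v; case: t; rewrite /lead /s; bexpand;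
  bnorm ij jk kl eK l; lra.
Qed.

Lemma lift_12_23_24 i j k l t : (i < j)%N -> (j < k)%N -> (k < l)%N ->
  K = (3 * M + i + j + j + j + k + l).+1 ->
  G (jacobiator mon (h ybe) (t, (i, j)) (true, (j, k)) (true, (j, l))) = 0.
Proof.
move=> ij jk kl eK; have leK : (K <= 4 * M)%N.
  have := ltn_ord i; have := ltn_ord j; have := ltn_ord k; have := ltn_ord l; lia.
have := zamolodchikov leK (i := i) (j := j) (k := l) (l := k) ltac:(lia).
have := zamolodchikov leK (i := i) (j := k) (k := j) (l := l) ltac:(lia).
have := zamolodchikov leK (i := i) (j := k) (k := l) (l := j) ltac:(lia).
have := zamolodchikov leK (i := i) (j := l) (k := j) (l := k) ltac:(lia).
have := zamolodchikov leK (i := j) (j := l) (k := k) (l := i) ltac:(lia).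
have := zamolodchikov leK (i := k) (j := j) (k := l) (l := i) ltac:(lia).
have := zamolodchikov leK (i := k) (j := l) (k := j) (l := i) ltac:(lia).
have := zamolodchikov leK (i := l) (j := j) (k := k) (l := i) ltac:(lia).
bexpand; bnorm ij jk kl eK l.
move=> z1 z2 z3 z4 z5 z6 z7 z8; rewrite jacobi_bcomm /=; last lia.
rewrite !rel_low; try lia.
rewrite !rel_chain; try lia.
rewrite !x_lead; try lia.
case: t; rewrite /lead /s; bexpand;
  bnorm ij jk kl eK l; lra.
Qed.

Lemma lift_path i j k l t : (i < j)%N -> (j < k)%N -> (k < l)%N ->
  K = (3 * M + i + j + j + k + k + l).+1 ->
  G (jacobiator mon (h ybe) (t, (i, j)) (true, (j, k)) (true, (k, l))) = 0.
Proof.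
move=> ij jk kl eK; have leK : (K <= 4 * M)%N.
  have := ltn_ord i; have := ltn_ord j; have := ltn_ord k; have := ltn_ord l; lia.
have := zamolodchikov leK (i := i) (j := j) (k := k) (l := l) ltac:(lia).
have := zamolodchikov leK (i := i) (j := j) (k := l) (l := k) ltac:(lia).
have := zamolodchikov leK (i := i) (j := k) (k := l) (l := j) ltac:(lia).
have := zamolodchikov leK (i := i) (j := l) (k := k) (l := j) ltac:(lia).
have := zamolodchikov leK (i := j) (j := k) (k := l) (l := i) ltac:(lia).
have := zamolodchikov leK (i := j) (j := l) (k := k) (l := i) ltac:(lia).
have := zamolodchikov leK (i := k) (j := l) (k := j) (l := i) ltac:(lia).
have := zamolodchikov leK (i := l) (j := k) (k := j) (l := i) ltac:(lia).
bexpand; bnorm ij jk kl eK l.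
move=> z1 z2 z3 z4 z5 z6 z7 z8; rewrite jacobi_bcomm /=; last lia.
rewrite (rel_disj _ _ (a := (t, (i, j))) (b := (true, (k, l))));
  last by rewrite /disj /= -!val_eqE /=; lia.
rewrite !rel_chain; try lia.
rewrite !x_lead; try lia.
case: t; rewrite /lead /s; bexpand;
  bnorm ij jk kl eK l; lra.
Qed.

End Kill.

(** * Reduction of all hexagons to six trees on four indices *)

Implicit Type G : {linear B -> rat^o}.
Local Notation V := (W predT).
Local Notation jacobi := (jacobiator mon (h ybe)).

Lemma sigma_anti a b : comm a b -> sigma ybe b a = - sigma ybe a b.
Proof.
by case/and3P=> _ _; rewrite /sigma; case: ltngtP => // _ _; rewrite opprK.
Qed.

Lemma jacobi_rot a b c : jacobi b c a = jacobi a b c.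
Proof. by rewrite /jacobiator [LHS]addrC addrA. Qed.

Lemma jacobi_swap a b c : comm a b -> comm a c -> comm b c ->
  jacobi b a c = - jacobi a b c.
Proof.
move=> cab cac cbc; rewrite /jacobiator !crelE.
rewrite (sigma_anti cab) (sigma_anti cac) (sigma_anti cbc).
move: (sigma ybe a b) (sigma ybe a c) (sigma ybe b c) (x a) (x b) (x c).
move=> p q s y z w; ncr.
Qed.

(** The letter [c] is moved through each word of [p]; every crossing costs a commutator of disjoint
    letters, which is itself a relator. *)
Lemma kills_disj K G (I : seq 'I_n) c m p : kills mon wt (@comm n) (h ybe) K G ->
  legit c -> c.2.1 \notin I -> c.2.2 \notin I -> W (on I) m p ->
  (K <= m + wt c)%N -> G (br p (x c)) = 0.
Proof.
move=> GK lc c1 c2 Wp le.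
suff H w u v : all (on I) w -> (K <= wwt wt u + wwt wt w + wt c + wwt wt v)%N ->
    G (mon u * br (mon w) (x c) * mon v) = 0.
  elim: Wp => [|d w q /andP[Iw mw] _ IH]; first by rewrite /br mul0r mulr0 subr0 linear0.
  have -> : br (d *: mon w + q) (x c) = d *: br (mon w) (x c) + br q (x c).
    rewrite /br mulrDl mulrDr -scalerAl -scalerAr scalerBr.
    by rewrite opprD addrACA.
  rewrite linearP /= IH addr0.
  have := H w [::] [::] Iw; rewrite mon0 mul1r mulr1 => ->; first by rewrite scaler0.
  by rewrite !wwtE; lia.
elim: w u => [|e w IH] u /=.
  by move=> *; rewrite mon0 /br mul1r mulr1 subrr mulr0 mul0r linear0.
case/andP=> /and3P[le' e1 e2] Iw; rewrite !wwtE => leK.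
have d : disj e c.
  by rewrite /disj; apply/and4P; split; apply/eqP => E; move: c1 c2;
    rewrite -?E ?e1 ?e2.
have -> : mon u * br (mon (e :: w)) (x c) * mon v =
    mon (rcons u e) * br (mon w) (x c) * mon v
    + mon u * sigma ybe e c * mon (w ++ v).
  rewrite rel_disj // -cats1 !monM (mon_cons monM) /br /letx.
  by move: (mon u) (mon [:: e]) (mon w) (mon [:: c]) (mon v) => p1 p2 p3 p4 p5; ncr.
rewrite linearD /= IH // ?add0r; last by rewrite -cats1 !wwtE; lia.
rewrite -crelE GK ?comm_disj //; rewrite !wwtE; lia.
Qed.

(** The relators with [c] are plain commutators, so the Jacobi identity leaves the commutator of
    [h ybe a b] with [c]. The correction involves only indices of [a] and [b], and its excess weight
    reaches the threshold. *)
Lemma lift_disj G a b c : comm a b -> legit c -> disj a c -> disj b c ->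
  kills mon wt (@comm n) (h ybe) (wt a + wt b + wt c).+1 G -> G (jacobi a b c) = 0.
Proof.
move=> cab lc ac bc GK.
have [la lb _] := and3P cab.
have -> : jacobi a b c = - br (h ybe a b) (x c).
  rewrite /jacobiator !crelE (sigma_anti (comm_disj la lc ac)) (rel_disj _ ac) (rel_disj _ bc).
  rewrite /h /br.
  by move: (sigma ybe a b) (x a) (x b) (x c) => p1 p2 p3 p4; ncr.
rewrite linearN /= (kills_disj GK lc _ _ (h_W cab)) ?oppr0 //.
- by move: ac bc; rewrite /isupp /supp !inE => /and4P[a1 a2 a3 a4] /and4P[b1 b2 b3 b4];
    rewrite ![c.2.1 == _]eq_sym !negb_or a1 a3 b1 b3.
- by move: ac bc; rewrite /isupp /supp !inE => /and4P[a1 a2 a3 a4] /and4P[b1 b2 b3 b4];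
    rewrite ![c.2.2 == _]eq_sym !negb_or a2 a4 b2 b4.
Qed.

Lemma lift_sorted G a b c : (a.2.2 < b.2.2)%N -> (b.2.2 < c.2.2)%N ->
  comm a b -> comm a c -> comm b c ->
  kills mon wt (@comm n) (h ybe) (wt a + wt b + wt c).+1 G -> G (jacobi a b c) = 0.
Proof.
move=> lab lbc cab cac cbc GK.
have dj (t1 t2 : bool) (p q s y : 'I_n) : p <> s :> nat /\ p <> y :> nat /\ q <> s :> nat /\
    q <> y :> nat -> disj (t1, (p, q)) (t2, (s, y)).
  by rewrite /disj /= -!val_eqE /=; lia.
move: lab lbc (cab) (cac) (cbc) GK; rewrite /comm.
case: a cab cac => [t [i j]] cab cac; case: b cab cbc => [u [i' k]] cab cbc.
case: c cac cbc => [v [i'' l]] cac cbc /= jk kl.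
rewrite jk kl (ltn_trans jk kl) /legit /lcomm /=.
case/and3P=> ij ik' c1 /and3P[_ il c2] /and3P[_ _ c3] GK.
have [e1|n1] := eqVneq i' i.
  subst i'; have [e2|n2] := eqVneq i'' i.
    by subst i''; apply: (lift_star GK) => //; rewrite /wt /=; lia.
  have [e3|n3] := eqVneq i'' j.
    subst i''; rewrite eqxx /= in c2; have ev : v = true := c2; subst v.
    by apply: (lift_12_13_24 GK) => //; rewrite /wt /=; lia.
  have [e4|n4] := eqVneq i'' k.
    subst i''; rewrite eqxx /= in c3; have ev : v = true := c3; subst v.
    by apply: (lift_12_13_34 GK) => //; rewrite /wt /=; lia.
  by apply: lift_disj GK => //; apply: dj; move: n2 n3 n4; rewrite -!val_eqE /=; lia.
have [e1|n2] := eqVneq i' j.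
  subst i'; rewrite eqxx /= in c1; have eu : u = true := c1; subst u.
  have [e2|n2] := eqVneq i'' i.
    by subst i''; apply: (lift_12_23_14 GK) => //; rewrite /wt /=; lia.
  have [e3|n3] := eqVneq i'' j.
    subst i''; rewrite eqxx /= in c2; have ev : v = true := c2; subst v.
    by apply: (lift_12_23_24 GK) => //; rewrite /wt /=; lia.
  have [e4|n4] := eqVneq i'' k.
    subst i''; rewrite eqxx /= in c3; have ev : v = true := c3; subst v.
    by apply: (lift_path GK) => //; rewrite /wt /=; lia.
  by apply: lift_disj GK => //; apply: dj; move: n2 n3 n4; rewrite -!val_eqE /=; lia.
(* Here [a] and [b] share no index. If [c] meets [a], then [b] is disjoint from the other two
   letters; otherwise [a] is. *)
have [e|n3] := boolP ((i'' == i) || (i'' == j)).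
  apply/eqP; rewrite -oppr_eq0 -linearN -jacobi_swap // -jacobi_rot; apply/eqP.
  apply: lift_disj => //; rewrite 1?addnAC //.
  - by apply: dj; move: n1 n2 e; rewrite -!val_eqE /=; lia.
  - by apply: dj; move: n1 n2 e; rewrite -!val_eqE /=; lia.
rewrite -jacobi_rot; apply: lift_disj => //.
- by apply: dj; move: n1 n2 n3; rewrite -!val_eqE /=; lia.
- by apply: dj; move: n1 n2 n3; rewrite -!val_eqE /=; lia.
- by rewrite addnC addnA.
Qed.

Theorem jacobi_vanish G a b c : comm a b -> comm a c -> comm b c ->
  kills mon wt (@comm n) (h ybe) (wt a + wt b + wt c).+1 G -> G (jacobi a b c) = 0.
Proof.
have hi e f : comm e f -> (e.2.2 < f.2.2)%N \/ (f.2.2 < e.2.2)%N.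
  by case/and3P=> _ _; case: ltngtP => // *; [left|right].
have sw e f g : comm e f -> comm e g -> comm f g ->
    G (jacobi f e g) = 0 -> G (jacobi e f g) = 0.
  move=> ef eg fg; rewrite jacobi_swap // linearN => /eqP.
  by rewrite oppr_eq0 => /eqP.
move=> cab cac cbc GK.
have [cba cca ccb] : [/\ comm b a, comm c a & comm c b].
  by rewrite comm_sym cab comm_sym cac comm_sym cbc.
have GK' w : (wt a + wt b + wt c)%N = w -> kills mon wt (@comm n) (h ybe) w.+1 G by move<-.
have [ab|ba] := hi _ _ cab; have [bc|cb] := hi _ _ cbc; have [ac|ca] := hi _ _ cac;
  try (exfalso; lia).
- by apply: lift_sorted.
- by apply: (sw _ _ _) => //; rewrite -jacobi_rot; apply: lift_sorted => //; apply: GK'; lia.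
- by rewrite -jacobi_rot -jacobi_rot; apply: lift_sorted => //; apply: GK'; lia.
- by apply: (sw _ _ _) => //; apply: lift_sorted => //; apply: GK'; lia.
- by rewrite -jacobi_rot; apply: lift_sorted => //; apply: GK'; lia.
- apply: (sw _ _ _) => //; rewrite -jacobi_rot -jacobi_rot; apply: lift_sorted => //.
  by apply: GK'; lia.
Qed.
End Relations.

(** * Powers of the augmentation ideal *)

Section GroupRing.
Context (n : nat).
Local Notation A := (fa (letter n)).
Implicit Types (f g : A) (w : word n).

Lemma wdE w : wd w = fword w :> A.
Proof. by rewrite unlock. Qed.

Lemma augE f : aug f = linext (V := rat^o) (fun _ => 1) f.
Proof. by rewrite /linext /ext; apply: eq_bigr => m _; rewrite [RHS]mulr1. Qed.

Lemma aug_mon w : aug (fword w : A) = 1.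
Proof. by rewrite augE linext_word. Qed.

Lemma augP c f g : aug (c *: f + g : A) = c * aug f + aug g.
Proof. by rewrite !augE linearP. Qed.

Lemma augZ c f : aug (c *: f : A) = c * aug f.
Proof. by rewrite !augE linearZ. Qed.

Lemma augB f g : aug (f - g : A) = aug f - aug g.
Proof. by rewrite !augE linearB. Qed.

Lemma aug1 : aug (1 : A) = 1.
Proof. by rewrite -fword0 aug_mon. Qed.

Lemma augM f g : aug (f * g : A) = aug f * aug g.
Proof.
elim/fa_ind: f => [|c f f' IH IH'|u].
- by rewrite mul0r !augE linear0 mul0r.
- by rewrite mulrDl -(scalerAl c f g) !augP mulrDl -mulrA; congr (_ * _ + _).
elim/fa_ind: g => [|c g g' IH IH'|v].
- by rewrite mulr0 !augE linear0 mulr0.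
- by rewrite mulrDr -(scalerAr c _ g) !augP mulrDr mulrCA; congr (_ * _ + _).
by rewrite -fwordM !aug_mon mulr1.
Qed.

Lemma J_add f g : in_J f -> in_J g -> in_J (f + g : A).
Proof.
move=> Jf Jg; elim: Jf => [|c w1 w2 f' e _ IH]; first by rewrite add0r.
by rewrite -addrA; apply: Jrel.
Qed.

Lemma J_scale c f : in_J f -> in_J (c *: f : A).
Proof.
elim=> [|c' w1 w2 f' e _ IH]; first by rewrite scaler0; apply: J0.
by rewrite scalerDr scalerA; apply: Jrel.
Qed.

Lemma J_rel w1 w2 : pvb_eq w1 w2 -> in_J (fword w1 - fword w2 : A).
Proof.
move=> e; rewrite -[_ - _]addr0 -[fword w1 - _]scale1r -!wdE.
by apply: Jrel => //; apply: J0.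
Qed.

Lemma pvb_eq_ctx u v w1 w2 : pvb_eq w1 w2 -> pvb_eq (u ++ w1 ++ v) (u ++ w2 ++ v).
Proof.
elim=> [w|w w' _ IH|w w' w'' _ IH _ IH'|u' v' w w' e]; first exact: pvb_refl.
- exact: pvb_sym.
- exact: pvb_trans IH IH'.
- by rewrite -!catA !catA -!(catA _ w) -!(catA _ w') -!catA; rewrite !(catA u); apply: pvb_ctx.
Qed.

Lemma J_mon u v f : in_J f -> in_J (fword u * f * fword v : A).
Proof.
elim=> [|c w1 w2 f' e _ IH]; first by rewrite mulr0 mul0r; apply: J0.
rewrite mulrDr mulrDl; apply: J_add IH; rewrite -scalerAr -scalerAl; apply: J_scale.
rewrite !wdE mulrBr mulrBl -!fwordM -!catA; apply: J_rel; apply: pvb_eq_ctx e.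
Qed.

Lemma J_mull g f : in_J f -> in_J (g * f : A).
Proof.
move=> Jf; elim/fa_ind: g => [|c g g' IH IH'|u]; first by rewrite mul0r; apply: J0.
  by rewrite mulrDl -(scalerAl c g f); exact: J_add (J_scale _ IH) IH'.
by have := J_mon u [::] Jf; rewrite fword0 mulr1.
Qed.

Lemma J_mulr g f : in_J f -> in_J (f * g : A).
Proof.
move=> Jf; elim/fa_ind: g => [|c g g' IH IH'|u]; first by rewrite mulr0; apply: J0.
  by rewrite mulrDr -(scalerAr c f g); exact: J_add (J_scale _ IH) IH'.
by have := J_mon [::] u Jf; rewrite fword0 mul1r.
Qed.

Lemma Ipow_scale d c f : in_Ipow d f -> in_Ipow d (c *: f : A).
Proof.
elim=> {d f} [f|d a b a0 Ib _|d f g _ IH _ IH'|d f g Jfg _ IH]; first exact: Ipow0.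
- by rewrite scalerAl; apply: IpowM => //; rewrite augZ a0 mulr0.
- by rewrite scalerDr; apply: IpowD.
- by apply: IpowJ IH; rewrite -scalerBr; apply: J_scale.
Qed.

Lemma Ipow_opp d f : in_Ipow d f -> in_Ipow d (- f : A).
Proof. by rewrite -scaleN1r; apply: Ipow_scale. Qed.

Lemma Ipow_sub d f g : in_Ipow d f -> in_Ipow d g -> in_Ipow d (f - g : A).
Proof. by move=> If Ig; apply: IpowD => //; apply: Ipow_opp. Qed.

Lemma Ipow_zero d : in_Ipow d (0 : A).
Proof.
elim: d => [|d IH]; first exact: Ipow0.
by rewrite -(mul0r 0); apply: IpowM => //; rewrite augE linear0.
Qed.

Lemma Ipow_J d f : in_J f -> in_Ipow d f.
Proof. by move=> Jf; apply: IpowJ (Ipow_zero d); rewrite subr0. Qed.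

Lemma Ipow_mull d g f : in_Ipow d f -> in_Ipow d (g * f : A).
Proof.
elim=> {d f} [f|d a b a0 Ib _|d f f' _ IH _ IH'|d f f' Jf _ IH]; first exact: Ipow0.
- by rewrite mulrA; apply: IpowM => //; rewrite augM a0 mulr0.
- by rewrite mulrDr; apply: IpowD.
- by apply: IpowJ IH; rewrite -mulrBr; apply: J_mull.
Qed.

Lemma Ipow_weak d f : in_Ipow d.+1 f -> in_Ipow d f.
Proof.
suff H e : in_Ipow e f -> forall c, e = c.+1 -> in_Ipow c f by move/H; apply.
elim=> {e f} [|e a b _ Ib _ c [<-]|e f g _ IH _ IH' c ec|e f g Jfg _ IH c ec] //.
- exact: Ipow_mull.
- by apply: IpowD; [apply: IH|apply: IH'].
- by apply: IpowJ Jfg _; apply: IH.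
Qed.

Lemma Ipow_mul c d f g : in_Ipow c f -> in_Ipow d g -> in_Ipow (c + d) (f * g : A).
Proof.
move=> If Ig; elim: If => {c f} [f|c a b a0 _ IH|c f f' _ IH _ IH'|c f f' Jf _ IH].
- exact: Ipow_mull.
- by rewrite -mulrA addSn; apply: IpowM.
- by rewrite mulrDl; apply: IpowD.
- by apply: IpowJ IH; rewrite -mulrBl; apply: J_mulr.
Qed.

Lemma Ipow1 f : aug f = 0 -> in_Ipow 1 f.
Proof. by move=> f0; rewrite -[f]mulr1; apply: IpowM => //; apply: Ipow0. Qed.

End GroupRing.

(** * Generation in degree one *)

Lemma affine_comb (V : lmodType rat) (c s t : rat) (o f g p q : V) :
  c *: (f - (s *: o + p)) + (g - (t *: o + q)) =
  c *: f + g - ((c * s + t) *: o + (c *: p + q)).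
Proof.
rewrite scalerBr scalerDr scalerA scalerDl addrACA -opprD.
by congr (_ - _); rewrite addrACA.
Qed.

Section Surjectivity.
Context (n : nat).
Local Notation A := (fa (letter n)).
Local Notation X := (fa (gen n)).
Implicit Types (f g : A) (w : word n).

Definition lft : X -> A := free_hom (fun a => fword [:: pos a] - 1 : A).
HB.instance Definition _ := GRing.LRMorphism.on lft.

Lemma liftE (p : X) : Defs.lift p = lft p.
Proof.
apply: eq_bigr => m _; congr (_ *: _).
by apply: eq_bigr => a _; rewrite wdE.
Qed.

Lemma homogP d (p : X) : homog d p <-> span (@fword (gen n)) (fun w : seq (gen n) => size w == d) p.
Proof.
split=> [hp|].
  rewrite [p]malg_sum big_seq; apply: (big_ind (span (@fword (gen n)) _)).
  - exact: span0.
  - by move=> p1 p2; apply: spanD.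
  - move=> [w] /hp sw; apply: spanZ.
    have -> : << FMonom w >> = fword w :> X by rewrite unlock.
    by apply: span_mon; rewrite sw.
elim=> [|c w q /eqP sw _ IH] m; first by rewrite msupp0.
move/(fsubsetP (msuppD_le _ _)); rewrite in_fsetU => /orP[|/IH //].
move/(fsubsetP (msuppZ_le _ _)); rewrite unlock msuppU1 in_fset1 => /eqP ->.
exact: sw.
Qed.

Lemma homog0 d : homog d (0 : X).
Proof. by apply/homogP/span0. Qed.

Lemma homogD d (p q : X) : homog d p -> homog d q -> homog d (p + q).
Proof. by move=> /homogP hp /homogP hq; apply/homogP/spanD. Qed.

Lemma homogZ d c (p : X) : homog d p -> homog d (c *: p).
Proof. by move=> /homogP hp; apply/homogP/spanZ. Qed.

Lemma homogM c d (p q : X) : homog c p -> homog d q -> homog (c + d) (p * q).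
Proof.
move=> /homogP hp /homogP hq; apply/homogP; apply: spanM hp hq; first exact: fwordM.
by move=> u v /eqP <- /eqP <-; rewrite size_cat.
Qed.

Lemma homog_word (w : seq (gen n)) : homog (size w) (fword w : X).
Proof. by apply/homogP/span_mon. Qed.

Lemma lft1 a : lft (fword [:: a]) = fword [:: pos a] - 1.
Proof. by rewrite /lft free_hom_word big_seq1. Qed.

Lemma aug_pos (l : letter n) : aug (fword [:: l] - 1 : A) = 0.
Proof. by rewrite augB aug_mon aug1 subrr. Qed.

(** An inverse letter contributes minus the generator: if vu = 1, then (u - 1) + (v - 1) = -(v -
    1)(u - 1) lies in the square of the augmentation ideal. *)
Lemma letter_approx (l : letter n) : exists p : X,
  homog 1 p /\ in_Ipow 2 (fword [:: l] - 1 - lft p).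
Proof.
case: l => a [|].
  exists (fword [:: a]); split; first exact: (@homog_word [:: a]).
  by rewrite lft1 subrr; apply: Ipow_zero.
exists (- fword [:: a]); split.
  by rewrite -scaleN1r; apply: homogZ; apply: (@homog_word [:: a]).
rewrite raddfN /= lft1 opprK.
set u : A := fword _; set v : A := fword _.
have J : in_J (v * u - 1 : A).
  rewrite /u /v -fwordM -fword0; apply: J_rel.
  exact: (pvb_ctx [::] [::] (pvb_cancel a true)).
have -> : u - 1 + (v - 1) = (v * u - 1) - (v - 1) * (u - 1).
  by move: u v {J} => u v; ncr.
apply: Ipow_sub; first exact: Ipow_J.
by apply: (@Ipow_mul _ 1 1); apply: Ipow1; apply: aug_pos.
Qed.

Lemma word_approx w : exists p : X, homog 1 p /\ in_Ipow 2 (fword w - 1 - lft p).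
Proof.
elim: w => [|l w [p [hp Ip]]].
  by exists 0; split; [exact: homog0|rewrite fword0 subrr raddf0 subr0; exact: Ipow_zero].
have [q [hq Iq]] := letter_approx l.
exists (q + p); split; first exact: homogD.
rewrite -[l :: w]/([:: l] ++ w) fwordM raddfD /=.
have -> : fword [:: l] * fword w - 1 - (lft q + lft p) = (fword [:: l] - 1) * (fword w - 1)
    + (fword [:: l] - 1 - lft q) + (fword w - 1 - lft p).
  by move: (fword [:: l]) (fword w) (lft q) (lft p) => u v y z; ncr.
apply: IpowD => //; apply: IpowD => //.
apply: (@Ipow_mul _ 1 1); apply: Ipow1; first exact: aug_pos.
by rewrite augB aug_mon aug1 subrr.
Qed.

Lemma linear_approx f : exists p : X,
  homog 1 p /\ in_Ipow 2 (f - (aug f *: 1 + lft p)).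
Proof.
elim/fa_ind: f => [|c f g [p [hp Ip]] [q [hq Iq]]|w].
- exists 0; split; first exact: homog0.
  by rewrite augE linear0 scale0r raddf0 addr0 subr0; apply: Ipow_zero.
- exists (c *: p + q); split; first by apply: homogD => //; apply: homogZ.
  move: (IpowD (Ipow_scale c Ip) Iq); congr (in_Ipow 2 _).
  by rewrite augP [lft (_ + _)]linearP; apply: affine_comb.
- have [p [hp Ip]] := word_approx w; exists p; split=> //.
  by rewrite aug_mon scale1r opprD addrA.
Qed.

Lemma Ipow_surj d f : in_Ipow d f ->
  exists p : X, homog d p /\ in_Ipow d.+1 (f - Defs.lift p).
Proof.
elim=> {d f} [f|d a b a0 Ib [p [hp Ip]]|d f g _ [p [hp Ip]] _ [q [hq Iq]]|d f g J _ [p [hp Ip]]].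
- exists (aug f *: 1); split; first by rewrite -fword0; apply/homogZ/(@homog_word [::]).
  rewrite liftE linearZ /= rmorph1; apply: Ipow1.
  by rewrite augB augZ aug1 mulr1 subrr.
- have [q [hq Iq]] := linear_approx a; exists (q * p); split; first exact: (@homogM 1 d).
  rewrite liftE rmorphM /=; rewrite a0 scale0r add0r in Iq.
  have -> : a * b - lft q * lft p = (a - lft q) * b + lft q * (b - lft p).
    by move: (lft q) (lft p) => u v; ncr.
  rewrite liftE in Ip.
  have I1 := Ipow_mul Iq Ib.
  have I2 : in_Ipow 1 (lft q).
    have -> : lft q = a - (a - lft q) by rewrite opprB addrC subrK.
    exact: Ipow_sub (Ipow1 a0) (Ipow_weak Iq).
  have I3 := Ipow_mul I2 Ip.
  rewrite !addSn !add0n in I1 I3.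
  exact: IpowD I1 I3.
- exists (p + q); split; first exact: homogD.
  rewrite liftE raddfD /= opprD addrACA; rewrite !liftE in Ip Iq.
  exact: IpowD Ip Iq.
- exists p; split=> //; apply: IpowJ Ip.
  by rewrite opprB addrA subrK.
Qed.
End Surjectivity.

(** * Truncated Magnus expansion of the group ring *)

Lemma geom_mull (R : pzRingType) (p : R) m :
  (1 + p) * (\sum_(i < m) (- p) ^+ i) = 1 - (- p) ^+ m.
Proof. by rewrite -[RHS]opprB subrX1 -mulNr opprB opprK. Qed.

Lemma geom_mulr (R : pzRingType) (p : R) m :
  (\sum_(i < m) (- p) ^+ i) * (1 + p) = 1 - (- p) ^+ m.
Proof.
rewrite -geom_mull mulr_suml mulr_sumr; apply: eq_bigr => i _; apply/esym.
apply: commrX; apply: commrN; apply: commr_sym.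
by apply: commrD; [exact: commr1|exact: commr_refl].
Qed.

Section Injectivity.
Context (n d : nat).
Local Notation A := (fa (letter n)).
Local Notation X := (fa (gen n)).
Context (B : algType rat) (mon : seq (lett n) -> B).
Hypothesis mon0 : mon [::] = 1.
Hypothesis monM : forall u v, mon (u ++ v) = mon u * mon v.
Hypothesis mon_ind : forall P : B -> Prop, P 0 ->
  (forall c p q, P p -> P q -> P (c *: p + q)) -> (forall w, P (mon w)) -> forall p, P p.
(* Being larger than [6 * n], it makes cubic terms heavier than quadratic ones;
   being larger than [2 * n * d], it makes words of length [d.+1] heavier than
   words of length [d]. *)
Definition wbase := (6 * n + 2 * n * d).+1.
Local Notation M := wbase.

Lemma ltM : (6 * n < M)%N. Proof. by rewrite /wbase; lia. Qed.

Local Notation wt := (@wt n M).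
Local Notation W := (wspan mon wt).
Local Notation r := (rgen mon).
Local Notation ybe := (ybe mon).
Local Notation h := (corr mon).
Implicit Types (i j k l : 'I_n) (a b c e : lett n) (p q u v : B).

Definition rg (g : gen n) : B := r (val g).1 (val g).2.
(** Inverse of 1 + p up to a power of exponent d + 1, which for [p] of weight M is heavy enough to
    be ignored by the functional. *)
Definition geom p : B := \sum_(m < d.+1) (- p) ^+ m.
Definition tl (l : letter n) : B := if l.2 then 1 + rg l.1 else geom (rg l.1).
(** Magnus expansion R = 1 + r. It is defined on words, and the relations of the group hold only
    modulo [Ker]. *)
Definition letter_hom : A -> B := free_hom tl.
HB.instance Definition _ := GRing.LRMorphism.on letter_hom.
Definition gen_hom : X -> B := free_hom rg.
HB.instance Definition _ := GRing.LRMorphism.on gen_hom.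
Local Notation Theta := letter_hom.
Local Notation theta := gen_hom.

Lemma Theta_lft (p : X) : Theta (lft p) = theta p.
Proof.
elim/fa_ind: p => [|c p q IH IH'|w]; first by rewrite !raddf0.
  rewrite [lft _]linearP [Theta _]linearP [theta _]linearP /=.
  exact: (congr2 (fun y z => c *: y + z) IH IH').
rewrite /lft /theta !free_hom_word rmorph_prod; apply: eq_bigr => g _ /=.
by rewrite rmorphB rmorph1 /= /Theta free_hom_word big_seq1 /tl /= addrC addKr.
Qed.

Lemma W_all p : W predT 0 p.
Proof.
apply: (mon_ind (P := W predT 0)) => [|c q q' Wq Wq'|w]; first exact: span0.
  by apply: spanD => //; apply: spanZ.
by apply: W_mon; rewrite ?all_predT.
Qed.

Lemma neq_gen (g : gen n) : (val g).1 <> (val g).2 :> nat.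
Proof. by move=> E; have := valP g; rewrite (ord_inj E) eqxx. Qed.

Lemma W_rg g : W predT M (rg g).
Proof.
apply: (@W_sub _ _ _ _ (on [:: (val g).1; (val g).2])) => //.
by apply: (W_r _ ltM (@neq_gen g)); rewrite !inE eqxx ?orbT.
Qed.

Lemma W_exp m p : W predT M p -> W predT (m * M) (p ^+ m).
Proof.
move=> Wp; elim: m => [|m IH]; first exact: W_all.
by rewrite exprS mulSn; exact (WM monM Wp IH).
Qed.

Lemma W_geom p : W predT M p -> W predT M (geom p - 1).
Proof.
move=> Wp; rewrite /geom big_ord_recl expr0 addrC addKr.
apply: (big_ind (W predT M)); first exact: span0.
  by move=> *; apply: spanD.
move=> m _; apply: W_weak (W_exp _ _); last exact: spanN.
by rewrite /bump /= mulnDl mul1n leq_addr.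
Qed.

Lemma W_tl (l : letter n) : W predT M (tl l - 1).
Proof.
rewrite /tl; case: ifP => _; last exact/W_geom/W_rg.
by rewrite addrC addKr; apply: W_rg.
Qed.

Section Functional.
Variables (G : {linear B -> rat^o}).
Hypothesis G_W : forall w, (d.+1 * M <= wwt wt w)%N -> G (mon w) = 0.
Hypothesis G_kills : kills mon wt (@comm n) (h ybe) 0 G.

(** The largest two-sided ideal on which [G] vanishes. *)
Definition Ker p := forall u v, G (u * p * v) = 0.

Lemma KerD p q : Ker p -> Ker q -> Ker (p + q).
Proof. by move=> Kp Kq u v; rewrite mulrDr mulrDl linearD /= Kp Kq addr0. Qed.

Lemma KerZ (c : rat) p : Ker p -> Ker (c *: p).
Proof. by move=> Kp u v; rewrite -scalerAr -scalerAl linearZ /= Kp scaler0. Qed.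

Lemma Ker0 : Ker 0.
Proof. by move=> u v; rewrite mulr0 mul0r linear0. Qed.

Lemma KerN p : Ker p -> Ker (- p).
Proof. by move=> Kp u v; rewrite mulrN mulNr linearN /= Kp oppr0. Qed.

Lemma KerMl u p : Ker p -> Ker (u * p).
Proof. by move=> Kp u' v'; rewrite mulrA. Qed.

Lemma KerMr p v : Ker p -> Ker (p * v).
Proof. by move=> Kp u' v'; rewrite !mulrA -mulrA. Qed.

Lemma Ker_killed w p : killed mon M 0 G w p -> Ker p.
Proof. by move=> kp u v; apply: (kp u v 0 0) => //; apply: W_all. Qed.

Lemma Ker_W p : W predT (d.+1 * M) p -> Ker p.
Proof.
move=> Wp u v; have := WM monM (WM monM (W_all u) Wp) (W_all v).
rewrite add0n addn0; elim=> [|c w q /andP[_ /G_W Gw] _ IH]; first exact: linear0.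
by rewrite linearP /= Gw IH scaler0 addr0.
Qed.

Lemma Ker_step w1 w2 : pvb_step w1 w2 -> Ker (Theta (fword w1) - Theta (fword w2)).
Proof.
case=> [g b|i j k hij hik hjk|i j k l hij hik hil hjk hjl hkl];
  rewrite /Theta !free_hom_word !big_cons !big_nil !mulr1 /tl /rg /=.
- apply: (Ker_W (p := _)).
  have -> : (if b then 1 + r (val g).1 (val g).2 else geom (r (val g).1 (val g).2))
    * (if ~~ b then 1 + r (val g).1 (val g).2 else geom (r (val g).1 (val g).2)) - 1
    = - (- rg g) ^+ d.+1.
    by case: b; rewrite /= /geom ?geom_mull ?geom_mulr addrC addKr.
  by apply: spanN; apply: W_exp; apply: spanN; apply: W_rg.
- have -> : (1 + r i j) * ((1 + r i k) * (1 + r j k)) - (1 + r j k) * ((1 + r i k) * (1 + r i j))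
    = ybe i j k by rewrite ybeE !mulrA.
  by apply: Ker_killed (killed_ybe ltM G_kills _ _ _); apply/eqP; rewrite -?val_eqE.
- have -> : (1 + r i j) * (1 + r k l) - (1 + r k l) * (1 + r i j) = br (r i j) (r k l).
    by rewrite /br; move: (r i j) (r k l) => p q; ncr.
  apply: Ker_killed (killed_comm ltM G_kills _).
  by rewrite /= !inE !negb_or hij hik hil hjk hjl hkl.
Qed.

Lemma Ker_eq w1 w2 : pvb_eq w1 w2 -> Ker (Theta (fword w1) - Theta (fword w2)).
Proof.
elim=> {w1 w2} [w|w1 w2 _ IH|w1 w2 w3 _ IH _ IH'|u v w1 w2 e].
- by rewrite subrr; apply: Ker0.
- by rewrite -opprB; apply: KerN.
- by rewrite -(subrKA (Theta (fword w2))); apply: KerD.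
have := Ker_step e; rewrite /Theta !free_hom_word !big_cat /= -mulrBr -mulrBl => K.
exact/KerMl/KerMr.
Qed.

Lemma Ker_J (f : A) : in_J f -> Ker (Theta f).
Proof.
elim=> [|c w1 w2 f' e _ IH]; first by rewrite raddf0; apply: Ker0.
by rewrite linearP raddfB /= !wdE; apply: KerD => //; apply/KerZ/Ker_eq.
Qed.

Lemma W_Theta (f : A) : aug f = 0 -> W predT M (Theta f).
Proof.
suff H (g : A) : W predT M (Theta g - aug g *: 1).
  by move=> f0; have := H f; rewrite f0 scale0r subr0.
elim/fa_ind: g => [|c g g' IH IH'|w].
- by rewrite raddf0 augE linear0 scale0r subrr; apply: span0.
- rewrite augP linearP scalerDl -scalerA opprD addrACA -scalerBr.
  by apply: spanD => //; apply: spanZ.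
rewrite aug_mon scale1r /Theta free_hom_word; elim: w => [|l w IH].
  by rewrite big_nil subrr; apply: span0.
rewrite big_cons; set P := \prod_(_ <- _) _ in IH *.
have -> : tl l * P - 1 = (tl l - 1) * P + (P - 1) by rewrite mulrBl mul1r addrA subrK.
apply: spanD => //; have := WM monM (W_tl l) (W_all P); rewrite addn0; exact.
Qed.

(** Each factor of augmentation 0 contributes weight M. The heavy element [p] is only congruent to
    the expansion, because a lift of an element of the group ring is not unique. *)
Lemma Ker_Ipow m (f : A) : in_Ipow m f ->
  exists p, W predT (m * M) p /\ Ker (Theta f - p).
Proof.
elim=> {m f} [f|m a b a0 _ [p [Wp Kp]]|m f g _ [p [Wp Kp]] _ [q [Wq Kq]]|m f g J _ [p [Wp Kp]]].
- by exists (Theta f); rewrite subrr; split; [exact: W_all|exact: Ker0].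
- exists (Theta a * p); split; first by rewrite mulSn; exact (WM monM (W_Theta a0) Wp).
  by rewrite rmorphM /= -mulrBr; apply: KerMl.
- exists (p + q); split; first exact: spanD.
  by rewrite raddfD opprD addrACA; apply: KerD.
- exists p; split=> //.
  rewrite -(subrK (Theta g) (Theta f)) -addrA; apply: KerD => //.
  by rewrite -raddfB; apply: Ker_J.
Qed.

Lemma G_Ipow (f : A) : in_Ipow d.+1 f -> G (Theta f) = 0.
Proof.
move=> /Ker_Ipow [p [/Ker_W Kp Kf]].
have := Kf 1 1; have := Kp 1 1; rewrite !mul1r !mulr1 linearB /= => ->.
by rewrite subr0.
Qed.
End Functional.
End Injectivity.

Lemma rho_ybe (R : pzRingType) (a b c : R) : br a b + br a c + br b c =
  ((1 + a) * (1 + b) * (1 + c) - (1 + c) * (1 + b) * (1 + a)) - (a * b * c - c * b * a).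
Proof. by rewrite /br; ncr. Qed.

Lemma br_add1 (R : pzRingType) (a b : R) : br a b = (1 + a) * (1 + b) - (1 + b) * (1 + a).
Proof. by rewrite /br; ncr. Qed.

Lemma fword_prod (T : choiceType) (w : seq T) : fword w = \prod_(a <- w) fword [:: a] :> fa T.
Proof.
elim: w => [|a w IH]; first by rewrite big_nil fword0.
by rewrite big_cons -[a :: w]/([:: a] ++ w) fwordM IH.
Qed.

(** Total in [i] and [j], with value 0 on the diagonal, so that formulas need no proofs of
    inequality. *)
HB.lock Definition Xg (n : nat) (i j : 'I_n) : fa (gen n) :=
  oapp (fun g : gen n => fword [:: g]) 0 (insub (i, j)).
Canonical Xg_unlockable := Unlockable Xg.unlock.

(** * Reduction to normal words *)

Section Reduction.
Context (n d : nat).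
Local Notation A := (fa (letter n)).
Local Notation X := (fa (gen n)).
Implicit Types (i j k l : 'I_n) (a b c e : lett n).

Lemma Xg_gen (g : gen n) : Xg (val g).1 (val g).2 = fword [:: g].
Proof.
rewrite unlock -surjective_pairing; case: insubP => [g' _ e|]; last by rewrite (valP g).
by congr (fword [:: _]); apply: val_inj.
Qed.

Lemma Xg_Rg i j (ij : i != j) : Xg i j = fword [:: Rg ij].
Proof. exact: (Xg_gen (Rg ij)). Qed.

Definition etal a : X := if legit a then
  Xg a.2.1 a.2.2 + (if a.1 then Xg a.2.2 a.2.1 else 0) else 0.

Lemma homog_Xg i j : homog 1 (Xg i j).
Proof.
rewrite unlock; case: insubP => [g _ _|_] /=; last exact: homog0.
exact: (@homog_word _ [:: g]).
Qed.

Lemma homog_etal a : homog 1 (etal a).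
Proof.
rewrite /etal; case: ifP => _; last exact: homog0.
apply: homogD; first exact: homog_Xg.
by case: ifP => _; [exact: homog_Xg|exact: homog0].
Qed.

Lemma lft_Xg i j (ij : i != j) : 1 + lft (Xg i j) = fword [:: pos (Rg ij)] :> A.
Proof. by rewrite Xg_Rg lft1 addrC subrK. Qed.

Lemma Ipow_Xg i j : in_Ipow 1 (lft (Xg i j)).
Proof.
rewrite unlock; case: insubP => [g _ _|_] /=; last by rewrite raddf0; exact: Ipow_zero.
by rewrite lft1; apply/Ipow1/aug_pos.
Qed.

Lemma lft_homog m (p : X) : homog m p -> in_Ipow m (lft p).
Proof.
move/homogP; elim=> [|c w q /eqP <- _ IH]; first by rewrite raddf0; exact: Ipow_zero.
rewrite linearP; apply: IpowD => //; apply: Ipow_scale; elim: w {IH} => [|g w IH].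
  exact: Ipow0.
rewrite -[g :: w]/([:: g] ++ w) fwordM rmorphM /=.
have I1 : in_Ipow 1 (lft (fword [:: g])) by rewrite lft1; exact: Ipow1 (aug_pos _).
exact: Ipow_mul I1 IH.
Qed.

Lemma Ipow_ybe (a b c : A) (l1 l2 l3 : letter n) :
  1 + a = fword [:: l1] -> 1 + b = fword [:: l2] -> 1 + c = fword [:: l3] ->
  pvb_step [:: l1; l2; l3] [:: l3; l2; l1] ->
  in_Ipow 1 a -> in_Ipow 1 b -> in_Ipow 1 c ->
  in_Ipow 3 (br a b + br a c + br b c).
Proof.
move=> ea eb ec e Ia Ib Ic; rewrite (rho_ybe a b c) ea eb ec -!fwordM.
apply: Ipow_sub; first exact: Ipow_J (J_rel (pvb_ctx [::] [::] e)).
exact: Ipow_sub (Ipow_mul (Ipow_mul Ia Ib) Ic) (Ipow_mul (Ipow_mul Ic Ib) Ia).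
Qed.

Lemma Ipow_comm (a b : A) (l1 l2 : letter n) :
  1 + a = fword [:: l1] -> 1 + b = fword [:: l2] ->
  pvb_step [:: l1; l2] [:: l2; l1] -> in_Ipow 3 (br a b).
Proof.
move=> ea eb e; rewrite (br_add1 a b) ea eb -!fwordM.
exact: Ipow_J (J_rel (pvb_ctx [::] [::] e)).
Qed.

Lemma lft_rho i j k : i != j -> i != k -> j != k -> in_Ipow 3
  (br (lft (Xg i j)) (lft (Xg i k)) + br (lft (Xg i j)) (lft (Xg j k))
   + br (lft (Xg i k)) (lft (Xg j k))).
Proof.
move=> ij ik jk.
exact: (Ipow_ybe (lft_Xg ij) (lft_Xg ik) (lft_Xg jk) (pvb_ybe ij ik jk)
  (Ipow_Xg i j) (Ipow_Xg i k) (Ipow_Xg j k)).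
Qed.

Lemma lft_comm i j k l : uniq [:: i; j; k; l] ->
  in_Ipow 3 (br (lft (Xg i j)) (lft (Xg k l))).
Proof.
rewrite /= !inE !negb_or => /and4P[/and3P[ij ik il] /andP[jk jl] kl _].
exact: (Ipow_comm (lft_Xg ij) (lft_Xg kl) (pvb_comm ij ik il jk jl kl)).
Qed.

Definition quad_ker (q : X) := in_ker 1 q \/ in_ker 2 q.

Lemma ideal_scale (s : rat) (p : X) : in_ideal quad_ker p -> in_ideal quad_ker (s *: p).
Proof.
move=> Ip; have -> : s *: p = (s *: 1) * p * 1 by rewrite mulr1 -scalerAl mul1r.
exact: idealM.
Qed.

Context (B : algType rat) (mon : seq (lett n) -> B).
Hypothesis mon0 : mon [::] = 1.
Hypothesis monM : forall u v, mon (u ++ v) = mon u * mon v.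
Context (eta : {lrmorphism B -> X}).
Hypothesis eta_x : forall a, eta (mon [:: a]) = etal a.
Implicit Types (p q u v : B).

Local Notation M := (wbase n d).
Local Notation ltM := (ltM n d).
Local Notation wt := (@wt n M).
Local Notation x := (letx mon).
Local Notation Wd := (wspand mon wt (@legit n)).
Local Notation r := (rgen mon).
Local Notation rho := (rho mon).
Local Notation h := (corr mon).
Local Notation sigma := (relator mon).

Lemma eta_r i j : i != j -> eta (r i j) = Xg i j.
Proof.
move=> ij; rewrite /rgen; case: ifP => [lij|nij].
  by rewrite eta_x /etal /legit /= lij addr0.
have lji : (j < i)%N by move: ij nij; rewrite -val_eqE /=; lia.
by rewrite raddfB /= !eta_x /etal /legit /= lji addr0 addrAC subrr add0r.
Qed.

Definition cubic p := in_Ipow 3 (lft (eta p)).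

Lemma cubicD p q : cubic p -> cubic q -> cubic (p + q).
Proof. by rewrite /cubic !raddfD; apply: IpowD. Qed.

Lemma cubicN p : cubic p -> cubic (- p).
Proof. by rewrite /cubic !raddfN; apply: Ipow_opp. Qed.

Lemma cubic0 : cubic 0.
Proof. by rewrite /cubic !raddf0; apply: Ipow_zero. Qed.

Lemma lft_eta_br p q : lft (eta (br p q)) = br (lft (eta p)) (lft (eta q)).
Proof. by rewrite /br raddfB /= raddfB /= 2!rmorphM /= 2!rmorphM. Qed.

Lemma lft_etaD p q : lft (eta (p + q)) = lft (eta p) + lft (eta q).
Proof. by rewrite raddfD /= raddfD. Qed.

Lemma lft_eta_brE p q (y z : X) : eta p = y -> eta q = z ->
  lft (eta (br p q)) = br (lft y) (lft z).
Proof. by move=> <- <-; apply: lft_eta_br. Qed.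

Lemma cubic_rho i j k : i != j -> i != k -> j != k -> cubic (rho i j k).
Proof.
move=> ij ik jk; rewrite /cubic.
have -> : lft (eta (rho i j k)) = br (lft (Xg i j)) (lft (Xg i k))
    + br (lft (Xg i j)) (lft (Xg j k)) + br (lft (Xg i k)) (lft (Xg j k)).
  apply: (etrans (lft_etaD _ _)); apply: congr2; last exact: lft_eta_brE (eta_r ik) (eta_r jk).
  by apply: (etrans (lft_etaD _ _)); apply: congr2;
    [exact: lft_eta_brE (eta_r ij) (eta_r ik)|exact: lft_eta_brE (eta_r ij) (eta_r jk)].
exact: lft_rho.
Qed.

Lemma cubic_comm i j k l : uniq [:: i; j; k; l] -> cubic (br (r i j) (r k l)).
Proof.
move=> U; have [ij kl] : i != j /\ k != l.
  by move: U; rewrite /= !inE !negb_or => /and4P[/and3P[-> _ _] _ -> _].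
rewrite /cubic (lft_eta_brE (eta_r ij) (eta_r kl)); exact: lft_comm.
Qed.

Ltac cubic_tac := rewrite /=; repeat match goal with
  | |- cubic (_ + _) => apply: cubicD
  | |- cubic (- _) => apply: cubicN
  | |- cubic 0 => exact: cubic0
  | |- cubic (rho _ _ _) => apply: cubic_rho
  end.

Lemma cubic_sigma a b : comm a b -> cubic (sigma rho a b).
Proof.
wlog lab : a b / (a.2.2 < b.2.2)%N => [IH|].
  move=> cab; have [|lba|e] := ltngtP a.2.2 b.2.2; first by move/IH; apply.
    have -> : sigma rho a b = - sigma rho b a.
      by rewrite /relator lba ltnNge (ltnW lba).
    by apply/cubicN/IH; rewrite // comm_sym.
  by case/and3P: cab; rewrite e ltnn.
case: a b lab => [t [i j]] [u [k l]] /= jl; rewrite /comm /legit /lcomm /= jl.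
case/and3P=> ij kl kju; rewrite /relator /= jl.
have ne (i1 i2 : 'I_n) : i1 <> i2 :> nat -> i1 != i2 by apply: ord_neq.
have [eki|nki] := eqVneq k i.
  subst k; case: u {kju}; case: t; cubic_tac; apply: ne; lia.
have [ekj|nkj] := eqVneq k j.
  subst k; case: t; cubic_tac; apply: ne; lia.
rewrite !x_lead //.
have U (a b c e : 'I_n) : perm_eq [:: val i; val j; val k; val l] [:: val a; val b; val c; val e] ->
    cubic (br (r a b) (r c e)).
  move=> pe; apply: cubic_comm; rewrite -(map_inj_uniq val_inj).
  rewrite -[map _ _]/([:: val a; val b; val c; val e]) -(perm_uniq pe) /=.
  by move: nki nkj; rewrite !inE -!val_eqE /= !negb_or; lia.
have bD p q z : br (p + q) z = br p z + br q z by rewrite /br; ncr.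
have bDr p q z : br z (p + q) = br z p + br z q by rewrite /br; ncr.
by case: t; case: u {kju}; rewrite /lead /sgen ?bD ?bDr; cubic_tac;
  apply: U; apply/permP => P /=; lia.
Qed.

Lemma h_rho_Wd a b : comm a b -> Wd 2 (wt a + wt b).+1 (h rho a b).
Proof.
wlog lab : a b / (a.2.2 < b.2.2)%N => [IH|].
  move=> cab; have [|lba|e] := ltngtP a.2.2 b.2.2; first by move/IH; apply.
    have cba : comm b a by rewrite comm_sym.
    by rewrite (h_anti _ _ cba) (addnC (wt a)); apply/spanN/IH.
  by case/and3P: cab; rewrite e ltnn.
case/and3P=> la lb; rewrite lab => lcab; rewrite (h_tail mon ltM la lb lab lcab).
apply: span_sub (tail_Wd monM ltM la lb lab lcab) => w.
rewrite /homw /heavy => /andP[/andP[aw ->] ->]; rewrite !andbT.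
by apply: sub_all aw => e /and3P[].
Qed.

Lemma homog_eta (m k : nat) p : Wd m k p -> homog m (eta p).
Proof.
elim=> [|c w q /andP[_ /eqP <-] _ IH]; first by rewrite raddf0; exact: homog0.
rewrite linearP; apply: homogD => //; apply: homogZ; elim: w {IH} => [|a w IH].
  by rewrite mon0 rmorph1 -fword0; exact: (@homog_word _ [::]).
rewrite -[a :: w]/([:: a] ++ w) monM rmorphM /= eta_x.
exact (homogM (@homog_etal a) IH).
Qed.

Lemma Wd_legit_x a : legit a -> Wd 1 0 (x a).
Proof. by move=> la; apply: span_mon; rewrite /homw /heavy /= la. Qed.

Lemma Wd_word w : all (@legit n) w -> Wd (size w) (wwt wt w) (mon w).
Proof. by move=> lw; apply: span_mon; rewrite /homw /heavy lw leqnn eqxx. Qed.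

Lemma sigma_ker a b : comm a b -> in_ker 2 (eta (sigma rho a b)).
Proof.
move=> cab; have [la lb _] := and3P cab; split; last first.
  by rewrite liftE; apply: cubic_sigma.
apply: (@homog_eta 2 0).
have -> : sigma rho a b = br (x a) (x b) - h rho a b.
  by rewrite /corr opprB addrC subrK.
apply: spanB; last exact: Wd_weak (h_rho_Wd cab).
by apply: spanB; apply: (WdM monM (d := 1) (e := 1) (j := 0) (k := 0)); apply: Wd_legit_x.
Qed.

(** The first half is the conclusion sought; the second ensures that reduction to normal words does
    not change the class in degree [d]. *)
Definition good p := in_ideal quad_ker (eta p) /\ in_Ipow d.+1 (lft (eta p)).

Lemma goodD p q : good p -> good q -> good (p + q).
Proof.
move=> [p1 p2] [q1 q2]; split; first by rewrite raddfD; exact: idealD p1 q1.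
by rewrite lft_etaD; exact: IpowD p2 q2.
Qed.

Lemma goodZ (c : rat) p : good p -> good (c *: p).
Proof.
move=> [p1 p2]; split; first by rewrite linearZ; exact: ideal_scale p1.
have -> : lft (eta (c *: p)) = c *: lft (eta p) by rewrite linearZ /= linearZ.
exact: Ipow_scale p2.
Qed.

Lemma good0 : good 0.
Proof.
split; first by rewrite raddf0; exact: ideal0.
have -> : lft (eta 0) = 0 by rewrite raddf0 /= raddf0.
exact: Ipow_zero.
Qed.

(** A quadratic relator lifts one step deeper than its degree, into the third power of the
    augmentation ideal, which brings the product to the power d + 1. *)
Lemma good_sigma (u v : seq (lett n)) a b :
  all (@legit n) u -> all (@legit n) v -> comm a b -> (size u + 2 + size v)%N = d ->
  good (mon u * sigma rho a b * mon v).
Proof.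
move=> lu lv cab sd.
have eM p q : eta (p * q) = eta p * eta q by exact: rmorphM.
have lM (p q : X) : lft (p * q) = lft p * lft q by exact: rmorphM.
rewrite /good !eM !lM; split; first by apply: idealM; apply: ideal_gen; right; apply: sigma_ker.
have Iw w : all (@legit n) w -> in_Ipow (size w) (lft (eta (mon w))).
  by move=> lw; apply: lft_homog; apply: (@homog_eta _ (wwt wt w)); apply: Wd_word.
have := Ipow_mul (Ipow_mul (Iw _ lu) (cubic_sigma cab)) (Iw _ lv).
by have -> : (size u + 3 + size v)%N = d.+1 by lia.
Qed.

Definition nfw : pred (seq (lett n)) := fun w => (nf (@comm n) w == w) && homw wt (@legit n) d 0 w.

Lemma homw_perm (k : nat) w w' : perm_eq w w' ->
  homw wt (@legit n) d k w = homw wt (@legit n) d k w'.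
Proof.
move=> pe; rewrite /homw /heavy (perm_all _ pe) (perm_size pe) /wwt.
by rewrite (perm_sumn (perm_map wt pe)).
Qed.

Lemma wwt_legit (w : seq (lett n)) : (wwt wt w <= size w * (M + 2 * n))%N.
Proof.
elim: w => [|a w IH] //; rewrite wwtE mulSn; apply: leq_add => //.
case: a => t [i j]; change (M + i + j <= M + 2 * n)%N.
by have := ltn_ord i; have := ltn_ord j; lia.
Qed.

Lemma wwt_lt (w : seq (lett n)) : size w = d -> (wwt wt w < d.+1 * M)%N.
Proof.
move=> sw; have := wwt_legit w; rewrite sw mulnDr mulSn.
have : (2 * n * d < M)%N by rewrite /wbase; lia.
by rewrite (mulnC d (2 * n)); lia.
Qed.

(** Sorting a word produces corrections of strictly larger weight. As they come from [rho], not
    [ybe], they keep the length [d], and words of that length have bounded weight. *)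
Lemma reduce (m k : nat) p : (d.+1 * M <= k + m)%N -> Wd d k p ->
  exists q, span mon nfw q /\ good (p - q).
Proof.
elim: m k p => [|m IH] k p km Wp.
  (* No word of length [d] is this heavy, so the combination is empty. *)
  exists 0; split; first exact: span0.
  elim: Wp => [|c w q /andP[/andP[_ kw] /eqP sw] _ _]; first by rewrite subr0; apply: good0.
  by have := wwt_lt sw; lia.
elim: Wp => [|c w q hw _ [q' [nq' gq']]].
  by exists 0; rewrite subr0; split; [apply: span0|apply: good0].
have [q1 [nq1 gq1]] : exists q1, span mon nfw q1 /\ good (mon w - q1); last first.
  exists (c *: q1 + q'); split; first by apply: spanD => //; apply: spanZ.
  by rewrite opprD addrACA -scalerBr; exact: goodD (goodZ c gq1) gq'.
(* The permutation transports length, weight and legitimacy from one word to the next, as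
   transitivity requires. *)
pose P (w w' : seq (lett n)) := perm_eq w w' /\ (homw wt (@legit n) d k w ->
  exists q, Wd d k.+1 q /\ good (mon w - mon w' - q)).
have [pe] : P w (nf (@comm n) w).
  apply: (nf_ind (@comm_sym n)) => [w1|w1 w2 w3 [p1 h1] [p2 h2]|u a b v cab].
  - split=> // _; exists 0; rewrite subrr subr0; split; [exact: span0|exact: good0].
  - split; first exact: perm_trans p1 p2.
    move=> hw1; have [r1 [s1 g1]] := h1 hw1.
    have [r2 [s2 g2]] : exists q, Wd d k.+1 q /\ good (mon w2 - mon w3 - q).
      by apply: h2; rewrite -(homw_perm _ p1).
    exists (r1 + r2); split; first exact: spanD.
    have -> : mon w1 - mon w3 - (r1 + r2) = (mon w1 - mon w2 - r1) + (mon w2 - mon w3 - r2).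
      by rewrite addrACA -opprD subrKA.
    exact: goodD g1 g2.
  - split; first by rewrite perm_cat2l (perm_catCA [:: a] [:: b] v).
    rewrite /homw /heavy all_cat size_cat /= !wwtE.
    case/andP=> /andP[/and4P[lu la lb lv] kw] /eqP sd.
    exists (mon u * h rho a b * mon v); split.
      have Wx := WdM monM (WdM monM (Wd_word lu) (h_rho_Wd cab)) (Wd_word lv).
      have e1 : (size u + 2 + size v)%N = d by rewrite -sd -addnA.
      have {}Wx := eq_ind _ (fun z => Wd z _ (mon u * h rho a b * mon v)) Wx _ e1.
      by apply: Wd_weak Wx; lia.
    have -> : mon (u ++ a :: b :: v) - mon (u ++ b :: a :: v) - mon u * h rho a b * mon v
        = mon u * sigma rho a b * mon v.
      rewrite !monM !(mon_cons monM) /corr /br.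
      by move: (mon u) (mon v) (x a) (x b) (sigma rho a b) => p1 p2 p3 p4 p5; ncr.
    by apply: good_sigma => //; rewrite -sd -addnA.
move=> /(_ hw) [q1 [Wq1 gq1]]; have [|q2 [nq2 gq2]] := IH k.+1 q1 _ Wq1; first by lia.
exists (mon (nf (@comm n) w) + q2); split.
  apply: spanD => //; apply: span_mon; rewrite /nfw nf_idem ?eqxx /=; last first.
  - exact: comm_irr.
  - exact: comm_sym.
  rewrite -(homw_perm _ pe); move: hw; rewrite /homw /heavy => /andP[/andP[-> _] ->] //.
have -> : mon w - (mon (nf (@comm n) w) + q2) =
    (mon w - mon (nf (@comm n) w) - q1) + (q1 - q2).
  by rewrite opprD addrA addrA subrK.
exact: goodD gq1 gq2.
Qed.
End Reduction.

(** * Comparison of the two bounds *)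

Section Quadraticity.
Context (n d : nat).
Local Notation X := (fa (gen n)).
Context (B : algType rat) (mon : seq (lett n) -> B).
Hypothesis mon0 : mon [::] = 1.
Hypothesis monM : forall u v, mon (u ++ v) = mon u * mon v.
Hypothesis mon_ind : forall P : B -> Prop, P 0 ->
  (forall c p q, P p -> P q -> P (c *: p + q)) -> (forall w, P (mon w)) -> forall p, P p.
Hypothesis mon_lin : forall f : seq (lett n) -> rat,
  exists g : {linear B -> rat^o}, forall w, g (mon w) = f w.
Hypothesis mon_sep : forall p : B, (forall L : {linear B -> rat^o}, L p = 0) -> p = 0.
Context (eta : {lrmorphism B -> X}).
Hypothesis eta_x : forall a, eta (mon [:: a]) = etal a.

Local Notation M := (wbase n d).
Local Notation ltM := (ltM n d).
Local Notation wt := (@wt n M).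
Local Notation Wd := (wspand mon wt (@legit n)).
Local Notation theta := (gen_hom mon).

Lemma eta_theta (p : X) : eta (theta p) = p.
Proof.
have thP c (p1 q1 : X) : theta (c *: p1 + q1) = c *: theta p1 + theta q1 by exact: linearP.
elim/fa_ind: p => [|c p1 q1 IH IH'|w].
- have -> : theta 0 = 0 by exact: raddf0.
  exact: raddf0.
- by rewrite thP linearP; apply: (congr2 (fun y z => c *: y + z) IH IH').
rewrite /gen_hom free_hom_word rmorph_prod fword_prod; apply: eq_bigr => g _.
exact: etrans (eta_r eta_x (valP g)) (Xg_gen g).
Qed.

Lemma theta_Xg i j : i != j -> theta (Xg i j) = rgen mon i j.
Proof. by move=> ij; rewrite (Xg_Rg ij) /gen_hom free_hom_word big_seq1. Qed.

Lemma theta_etal a : legit a -> theta (etal a) = letx mon a.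
Proof.
case: a => t [i j]; rewrite /etal => lij; rewrite lij; have {}lij : (i < j)%N := lij.
have ij : i != j by rewrite -val_eqE /= ltn_eqF.
have ji : j != i by rewrite eq_sym.
have thD (p1 q1 : X) : theta (p1 + q1) = theta p1 + theta q1 by exact: raddfD.
rewrite thD theta_Xg //=; case: t; first by rewrite theta_Xg // -/(sgen mon i j) -x_s.
have -> : theta 0 = 0 by exact: raddf0.
by rewrite addr0 -x_r.
Qed.

(** Restricted to legitimate letters, since [eta] sends the junk letters to 0. *)
Lemma theta_eta (Q : pred (seq (lett n))) p : subpred Q (all (@legit n)) ->
  span mon Q p -> theta (eta p) = p.
Proof.
have thP c (p1 q1 : X) : theta (c *: p1 + q1) = c *: theta p1 + theta q1 by exact: linearP.
have thM (p1 q1 : X) : theta (p1 * q1) = theta p1 * theta q1 by exact: rmorphM.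
have th1 : theta 1 = 1 by exact: rmorph1.
move=> sQ; elim=> [|c w q /sQ lw _ IH].
  have -> : eta 0 = 0 by exact: raddf0.
  exact: raddf0.
rewrite linearP thP IH; congr (_ *: _ + _).
elim: w lw => [|a w IHw] /=; first by rewrite mon0 (rmorph1 eta) th1.
case/andP=> la lw; rewrite (mon_cons monM) rmorphM thM IHw //.
congr (_ * _); exact: etrans (congr1 theta (eta_x a)) (theta_etal la).
Qed.

Lemma theta_Wd (p : X) : homog d p -> Wd d 0 (theta p).
Proof.
have thP c (p1 q1 : X) : theta (c *: p1 + q1) = c *: theta p1 + theta q1 by exact: linearP.
move/homogP; elim=> [|c w q /eqP <- _ IH].
  have -> : theta 0 = 0 by exact: raddf0.
  exact: span0.
rewrite thP; apply: spanD => //; apply: spanZ; rewrite /gen_hom free_hom_word.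
elim: w {IH} => [|g w IH]; first by rewrite big_nil -mon0; apply: span_mon.
rewrite big_cons; apply: (WdM monM (d := 1) (e := size w) (j := 0) (k := 0)) => //.
have := Wd_r mon ltM (I := [:: (val g).1; (val g).2]) (@neq_gen n g).
rewrite !inE !eqxx ?orbT => /(_ isT isT); apply: span_sub => v.
rewrite /homw /heavy => /andP[/andP[av _] ->]; rewrite !andbT.
by apply: sub_all av => e /and3P[].
Qed.

Theorem ker_quadratic (p : X) : in_ker d p -> in_ideal (@quad_ker n) p.
Proof.
case=> hp Ip.
have [|q [nq gq]] := reduce mon0 monM eta_x (m := (d.+1 * M)%N) (k := 0) _ (theta_Wd hp).
  by rewrite add0n.
suff q0 : q = 0.
  by case: gq => + _; rewrite q0 subr0 eta_theta.
have Iq : in_Ipow d.+1 (lft (eta q)).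
  have -> : lft (eta q) = lft p - lft (eta (theta p - q)).
    have -> : eta (theta p - q) = p - eta q.
      by exact: etrans (raddfB eta _ _) (congr1 (fun y => y - eta q) (eta_theta p)).
    by rewrite raddfB opprB addrC subrK.
  by rewrite liftE in Ip; exact: Ipow_sub Ip gq.2.
have hW a b : comm a b -> wspan mon wt predT (wt a + wt b).+1%N (corr mon (ybe mon) a b).
  by move=> cab; apply: W_sub (h_W monM ltM cab).
(* An arbitrary [L] is replaced by a functional [G] from [pbw] with the same values on the normal
   words of length [d], so that [L q = G q]. The expansion of the lift of [eta q] is [q] itself, and
   [G] vanishes on it because [Iq] places that lift in the power d + 1. *)
apply: mon_sep => L.
have Jac (G : {linear B -> rat^o}) a b c : comm a b -> comm a c -> comm b c ->
    kills mon wt (@comm n) (corr mon (ybe mon)) (wt a + wt b + wt c).+1%N G ->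
    G (jacobiator mon (corr mon (ybe mon)) a b c) = 0.
  by move=> cab cac cbc; move=> K; refine (jacobi_vanish mon0 monM ltM cab cac cbc K).
have hA a b : comm a b -> corr mon (ybe mon) b a = - corr mon (ybe mon) a b.
  exact: h_anti.
have [G [G0 Gk GL]] := pbw mon0 monM mon_lin (@comm_sym n) (@comm_irr n) hA hW Jac
  (d.+1 * M)%N (fun w => L (mon w)).
have := G_Ipow monM mon_ind G0 Gk Iq.
rewrite Theta_lft (@theta_eta (nfw d)) //; last first.
  by move=> w /andP[_ /andP[/andP[]]].
move=> <-; elim: nq => [|c w q1 /andP[/eqP nw /andP[_ /eqP sw]] _ IH].
  by rewrite !linear0.
by rewrite !linearP /= IH GL // wwt_lt.
Qed.
End Quadraticity.

Lemma fa_sep (T : choiceType) (p : fa T) :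
  (forall L : {linear fa T -> rat^o}, L p = 0) -> p = 0.
Proof.
move=> Lp; apply/malgP => m; rewrite mcoeff0.
pose L : {linear fa T -> rat^o} := linext (V := rat^o) (fun w => (FMonom w == m)%:R).
suff <- : L p = p@_m by apply: Lp.
elim/fa_ind: {Lp} p => [|c p q IH IH'|w]; first by rewrite linear0 mcoeff0.
  by rewrite linearP /= mcoeffD mcoeffZ; apply: (congr2 (fun y z => c * y + z) IH IH').
apply: etrans (linext_word (V := rat^o) _ w) _.
by rewrite unlock mcoeffU1.
Qed.

Theorem theorem5p1 (n : nat) : pvb_quadratic n.
Proof.
split=> [d f|d p kp]; first exact: Ipow_surj.
pose eta : fa (lett n) -> fa (gen n) := free_hom (@etal n).
have eta_x a : free_hom (@etal n) (fword [:: a]) = etal a by rewrite free_hom_word big_seq1.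
apply: (@ker_quadratic n d (fa (lett n)) (@fword (lett n)) (fword0 _) (@fwordM _) (@fa_ind _)
  _ (@fa_sep _) (free_hom (@etal n)) eta_x p kp) => f.
by exists (linext (V := rat^o) f) => w; apply: linext_word.
Qed.
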